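(* Let $q(m,n)=am^2+bmn+cn^2$ be a definite integral binary quadratic form, i.e. $a,b,c\in\mathbb{Z}$ with discriminant $\Delta(q)=b^2-4ac<0$. Let $1\le p\le\infty$ and $\lambda>0$. For $f:\mathbb{Z}\to\mathbb{C}$ define $$\mathcal{I}_{\lambda}f(n)=\sum_{m\in\mathbb{Z}\setminus\{0\}}\frac{f(q(m,n))}{|m|^{\lambda}},\qquad n\in\mathbb{Z}.$$ If either $p<\infty$ and $\lambda>1-p^{-1}$, or $p=\infty$ and $\lambda>1$, then there is a constant $C_{p,\lambda,\Delta(q)}$ depending only on $p,\lambda,\Delta(q)$ such that for all $f\in \ell^p(\mathbb{Z})$, $$\|\mathcal{I}_{\lambda}f\|_{\ell^p(\mathbb{Z})}\le C_{p,\lambda,\Delta(q)}\|f\|_{\ell^p(\mathbb{Z})}.$$ Moreover this is sharp in the following sense: (i) For every $r\in\mathbb{N}$ there exist a positive definite integral binary quadratic form $q$ and a nonnegative $f\in\ell^1(\mathbb{Z})$ such that $\|\mathcal{I}_{\log^r}f\|_{\ell^1}=\infty$, where $\mathcal{I}_{\log^r}f(n)=\sum_{m\in\mathbb{Z}\setminus\{0\}}\frac{f(q(m,n))}{\log^r(1+|m|)}$. (ii) For every $1<p<\infty$ there exist a positive definite integral binary quadratic form $q$ and a nonnegative $f\in\ell^p(\mathbb{Z})$ such that $\|\mathcal{I}_{1-p^{-1}}f\|_{\ell^p}=\infty$. (iii) For $p=\infty$ there exist a positive definite integral binary quadratic form $q$ and a nonnegative $f\in\ell^\infty(\mathbb{Z})$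 such that $\|\mathcal{I}_{1}f\|_{\ell^\infty}=\infty$.
   Context: An integral binary quadratic form is $q(m,n)=am^2+bmn+cn^2$ with $a,b,c\in\mathbb{Z}$, evaluated at integers $m,n$; its discriminant is $\Delta(q)=b^2-4ac$. It is called definite if $\Delta(q)<0$ and positive definite if in addition $a>0$. For nonnegative $f$ the sums defining the operators are sums of nonnegative terms and are allowed to equal $+\infty$. *)

(* Defs.v *)
From Stdlib Require Export Reals Lra ZArith.
Open Scope R_scope.

Definition Cx : Type := (R * R)%type.
Definition Cmod (z : Cx) : R := sqrt (fst z * fst z + snd z * snd z).

(* x^y for x >= 0, y > 0, with the convention 0^y = 0. *)
Definition rpow (x y : R) : R :=
  if Req_EM_T x 0 then 0 else Rpower x y.

Fixpoint sum_nat (g : nat -> R) (n : nat) : R :=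
  match n with
  | O => 0
  | S k => sum_nat g k + g k
  end.

Definition sumZ (N : nat) (g : Z -> R) : R :=
  g 0%Z + sum_nat (fun k => g (Z.of_nat (S k)) + g (- Z.of_nat (S k))%Z) N.

Definition sumZ0 (N : nat) (g : Z -> R) : R :=
  sum_nat (fun k => g (Z.of_nat (S k)) + g (- Z.of_nat (S k))%Z) N.

Definition qform (a b c m n : Z) : Z := (a * m * m + b * m * n + c * n * n)%Z.

Definition qdisc (a b c : Z) : Z := (b * b - 4 * a * c)%Z.

Definition absZpow (m : Z) (lam : R) : R := rpow (IZR (Z.abs m)) lam.

Definition I_converges_to (a b c : Z) (lam : R) (f : Z -> Cx) (n : Z) (s : Cx) : Prop :=
  Un_cv (fun N => sumZ0 N (fun m => fst (f (qform a b c m n)) / absZpow m lam)) (fst s) /\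
  Un_cv (fun N => sumZ0 N (fun m => snd (f (qform a b c m n)) / absZpow m lam)) (snd s).

Definition lp_bounded (p : R) (f : Z -> Cx) (B : R) : Prop :=
  forall N : nat, sumZ N (fun k => rpow (Cmod (f k)) p) <= rpow B p.

Definition linf_bounded (f : Z -> Cx) (B : R) : Prop :=
  forall k : Z, Cmod (f k) <= B.

(* Main.v *)
(** Boundedness.  Put d = -Delta.  The substitution X = 2cn + bm turns q(m,n) = k into
    X^2 + d m^2 = 4ck, so everything depends on representations by X^2 + d Y^2.

    Convexity with the weights |m|^(-sigma), sigma slightly above 1, gives
    (I|f|)(n)^p <= const * sum_m |f(q(m,n))|^p |m|^(-beta) for some beta > 0.  Summing over n
    and regrouping by the value k = q(m,n), it remains to bound the sum of |m|^(-beta) over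
    all solutions of q(m,n) = k with m <> 0, uniformly in k.  All but four of the solutions of
    X^2 + d m^2 = K have |m| >> K^(1/4), and there are only O(K^eps) of them: for primitive
    solutions, fix one (X0,Y0) and classify the others by g = gcd(K, X Y0 - X0 Y); two
    solutions in the same class satisfy K | 2d (X Y' - X' Y), which leaves boundedly many, and
    the number of classes is at most the number of divisors of K.

    Sharpness, always with q = m^2 + n^2.  For p = 1, numbers 2 P^j, with P = 9 times a
    product of t pairwise coprime values u^2 + 1, have at least (j+1)^t representations; take
    t = r + 3 and f(2 P^j) = (j+1)^(-2).  For 1 < p < oo the single value n = 0 already
    diverges for f(m^2) = m^(-1/p) / log m, and for p = oo so does f = 1. *)

Require Import Defs.
From Stdlib Require Import Reals ZArith Lra Lia List Znumtheory Zpow_facts FinFun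
  ClassicalEpsilon.
Import ListNotations.
Open Scope R_scope.

(** * The divisor bound *)

Section Divisors.
Local Open Scope Z_scope.

Definition divs (n : Z) : list Z :=
  filter (fun e => n mod e =? 0) (map Z.of_nat (seq 1 (Z.to_nat n))).

Definition tau (n : Z) : Z := Z.of_nat (length (divs n)).

Lemma in_divs (n e : Z) : 0 < n -> In e (divs n) <-> 0 < e /\ (e | n).
Proof.
  intros Hn. unfold divs. rewrite filter_In, in_map_iff, Z.eqb_eq. split.
  - intros [[x [<- Hx]] Hm]. apply in_seq in Hx. split; [lia|].
    apply Z.mod_divide in Hm; [exact Hm | lia].
  - intros [He Hd]. split.
    + exists (Z.to_nat e). pose proof (Z.divide_pos_le _ _ Hn Hd).
      split; [lia | apply in_seq; lia].
    + apply Z.mod_divide; [lia | exact Hd].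
Qed.

Lemma NoDup_divs (n : Z) : NoDup (divs n).
Proof.
  apply NoDup_filter, Injective_map_NoDup; [intros x y; lia | apply seq_NoDup].
Qed.

Lemma tau_divide (m n : Z) : 0 < n -> 0 < m -> (m | n) -> tau m <= tau n.
Proof.
  intros Hn Hm Hd. apply inj_le, NoDup_incl_length; [apply NoDup_divs|].
  intros e He. apply in_divs in He; [|lia]. apply in_divs; [lia|].
  split; [tauto | apply Z.divide_trans with m; tauto].
Qed.

(** Induction on [a]: if [p] divides [e], one factor [p] is cancelled on both sides; otherwise [e]
    is coprime to [p] and Gauss's lemma discards a factor [p] of the dividend. *)
Lemma divisor_prime_pow_mul (p m e : Z) (a : nat) :
  prime p -> 0 < e -> (e | p ^ Z.of_nat a * m) ->
  exists (i : nat) (e' : Z), (i <= a)%nat /\ 0 < e' /\ (e' | m) /\ e = p ^ Z.of_nat i * e'.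
Proof.
  intros Hp. pose proof (prime_ge_2 p Hp) as Hp2. revert e.
  induction a as [|a IH]; intros e He Hd.
  - exists 0%nat, e. rewrite Z.mul_1_l in *. auto.
  - assert (Hpow : p ^ Z.of_nat (S a) = p * p ^ Z.of_nat a)
      by (rewrite Nat2Z.inj_succ, Z.pow_succ_r; lia).
    rewrite Hpow, <- Z.mul_assoc in Hd.
    destruct (Zdivide_dec p e) as [[e1 ->]|Hpe].
    + destruct (IH e1) as (i & e' & Hi & He' & Hm & E); [nia| |].
      * apply (Z.mul_divide_cancel_l _ _ p); [lia|]. now rewrite (Z.mul_comm p e1).
      * exists (S i), e'. repeat split; auto; [lia|].
        rewrite Nat2Z.inj_succ, Z.pow_succ_r, E; [ring | lia].
    + destruct (IH e He) as (i & e' & Hi & He' & Hm & E).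
      * apply Gauss with p; [exact Hd | apply rel_prime_sym, prime_rel_prime; auto].
      * exists i, e'. repeat split; auto; lia.
Qed.

(** Each divisor arises from some pair [(i, e')] with [i <= a] and [e'] dividing [m]. Since [p] may
    divide [m], a divisor can come from several pairs, hence only an inequality. *)
Lemma tau_prime_pow_mul (p m : Z) (a : nat) :
  prime p -> 0 < m -> tau (p ^ Z.of_nat a * m) <= (Z.of_nat a + 1) * tau m.
Proof.
  intros Hp Hm. pose proof (prime_ge_2 p Hp) as Hp2.
  pose proof (Z.pow_pos_nonneg p (Z.of_nat a) ltac:(lia) ltac:(lia)) as Hpa.
  assert (H : (length (divs (p ^ Z.of_nat a * m)) <=
    length (map (fun ie : nat * Z => (p ^ Z.of_nat (fst ie) * snd ie)%Z)
             (list_prod (seq 0 (S a)) (divs m))))%nat).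
  { apply NoDup_incl_length; [apply NoDup_divs|].
    intros e He. apply in_divs in He; [|nia].
    destruct (divisor_prime_pow_mul p m e a) as (i & e' & Hi & He' & Hd & ->); try tauto.
    apply in_map_iff. exists (i, e'). split; [reflexivity|].
    apply in_prod; [apply in_seq; lia | apply in_divs; auto]. }
  rewrite length_map, length_prod, length_seq in H. unfold tau. nia.
Qed.

Lemma extract_power (p n : Z) : 1 < p -> 0 < n ->
  exists (a : nat) (m : Z), 0 < m /\ n = p ^ Z.of_nat a * m /\ ~ (p | m).
Proof.
  intros Hp Hn. assert (Hn0 : 0 <= n) by lia. revert Hn. pattern n.
  apply Z_lt_induction; [|exact Hn0]. clear n Hn0. intros n IH Hn.
  destruct (Zdivide_dec p n) as [[n1 E]|Hd].
  - destruct (IH n1) as (a & m & Hm & E1 & Hd); [nia | nia |].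
    exists (S a), m. repeat split; auto.
    rewrite Nat2Z.inj_succ, Z.pow_succ_r by lia. rewrite E, E1. ring.
  - exists 0%nat, n. repeat split; auto. lia.
Qed.

(** With y the integer part of a/s, a + 1 <= s (y + 1) <= s 2^y, and the s-th power of 2^y is at
    most 2^a. *)
Lemma succ_pow_le (s : Z) (a : nat) : 1 <= s ->
  (Z.of_nat a + 1) ^ s <= s ^ s * 2 ^ Z.of_nat a.
Proof.
  intros Hs. set (x := Z.of_nat a). set (y := x / s).
  assert (Hy : 0 <= y) by (apply Z.div_pos; lia).
  pose proof (Z.div_mod x s ltac:(lia)) as E. pose proof (Z.mod_pos_bound x s ltac:(lia)) as B.
  fold y in E.
  assert (Hy2 : y + 1 <= 2 ^ y) by (pose proof (Z.pow_gt_lin_r 2 y); lia).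
  apply Z.le_trans with ((s * 2 ^ y) ^ s); [apply Z.pow_le_mono_l; nia|].
  rewrite Z.pow_mul_l, <- Z.pow_mul_r by lia.
  apply Z.mul_le_mono_nonneg_l; [apply Z.pow_nonneg; lia|].
  apply Z.pow_le_mono_r; nia.
Qed.

(* The smallest divisor k > 1 of n is prime; splitting it off multiplies tau^s by at most
   (a+1)^s, which is at most k^a as soon as k >= 2^s. *)
Lemma tau_pow_le_aux (s : Z) (fuel : nat) (k n : Z) : 1 <= s -> 2 <= k -> 0 < n ->
  n + 1 - k <= Z.of_nat fuel -> (forall q, 1 < q < k -> ~ (q | n)) ->
  tau n ^ s <= (s ^ s) ^ Z.max 0 (2 ^ s - k) * n.
Proof.
  intros Hs. assert (Hss : 1 <= s ^ s) by (pose proof (Z.pow_pos_nonneg s s); lia).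
  revert k n. induction fuel as [|fuel IH]; intros k n Hk Hn Hf Hq.
  (* Without fuel, n < k, so n would be one of its own excluded divisors unless it equals 1. *)
  - assert (n = 1) as ->.
    { destruct (Z.eq_dec n 1); auto. exfalso. apply (Hq n); [lia | apply Z.divide_refl]. }
    change (tau 1) with 1. rewrite Z.pow_1_l by lia.
    pose proof (Z.pow_pos_nonneg (s ^ s) (Z.max 0 (2 ^ s - k))). lia.
  (* The exponent counts the integers from k up to 2^s - 1: each stage below 2^s may spend one
     factor s^s, later stages spend none. *)
  - assert (Hstep : (s ^ s) ^ Z.max 0 (2 ^ s - (k + 1)) *
      (if Z_lt_dec k (2 ^ s) then s ^ s else 1) = (s ^ s) ^ Z.max 0 (2 ^ s - k)).
    { destruct (Z_lt_dec k (2 ^ s)).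
      - replace (Z.max 0 (2 ^ s - k)) with (Z.succ (Z.max 0 (2 ^ s - (k + 1)))) by lia.
        rewrite Z.pow_succ_r by lia. ring.
      - rewrite Z.mul_1_r. f_equal. lia. }
    set (E := (s ^ s) ^ Z.max 0 (2 ^ s - (k + 1))) in *.
    assert (HE : 1 <= E) by (pose proof (Z.pow_pos_nonneg (s ^ s) (Z.max 0 (2 ^ s - (k + 1)))); lia).
    set (c := if Z_lt_dec k (2 ^ s) then s ^ s else 1) in *.
    assert (Hc : 1 <= c) by (unfold c; destruct Z_lt_dec; lia).
    rewrite <- Hstep.
    destruct (Zdivide_dec k n) as [Hkn|Hkn].
    + assert (Hp : prime k).
      { apply prime_alt. split; [lia|]. intros q Hq1 Hqk.
        apply (Hq q Hq1), Z.divide_trans with k; auto. }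
      destruct (extract_power k n) as (a & m & Hm & -> & Hkm); [lia | lia |].
      pose proof (Z.pow_pos_nonneg k (Z.of_nat a) ltac:(lia) ltac:(lia)) as Hka.
      assert (IHm : tau m ^ s <= E * m).
      { apply IH; [lia | lia | nia |].
        intros q Hq1 Hqm. destruct (Z.eq_dec q k) as [->|]; [contradiction|].
        apply (Hq q); [lia | apply Z.divide_mul_r; auto]. }
      assert (Ha : (Z.of_nat a + 1) ^ s <= c * k ^ Z.of_nat a).
      { unfold c. destruct Z_lt_dec as [_|Hk2].
        - apply Z.le_trans with (1 := succ_pow_le s a Hs).
          apply Z.mul_le_mono_nonneg_l; [lia | apply Z.pow_le_mono_l; lia].
        - rewrite Z.mul_1_l. apply Z.le_trans with ((2 ^ Z.of_nat a) ^ s).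
          + apply Z.pow_le_mono_l. pose proof (Z.pow_gt_lin_r 2 (Z.of_nat a)). lia.
          + rewrite <- Z.pow_mul_r, Z.mul_comm, Z.pow_mul_r by lia.
            apply Z.pow_le_mono_l. pose proof (Z.pow_nonneg 2 s). lia. }
      apply Z.le_trans with (((Z.of_nat a + 1) * tau m) ^ s).
      * apply Z.pow_le_mono_l. split; [unfold tau; lia | apply tau_prime_pow_mul; auto].
      * rewrite Z.pow_mul_l.
        assert (0 <= tau m ^ s) by (apply Z.pow_nonneg; unfold tau; lia).
        assert (0 <= (Z.of_nat a + 1) ^ s) by (apply Z.pow_nonneg; lia).
        apply Z.le_trans with ((c * k ^ Z.of_nat a) * (E * m)); [nia|].
        apply Z.eq_le_incl. ring.
    + apply Z.le_trans with (E * n); [|nia].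
      apply IH; [lia | lia | lia |].
      intros q Hq1. destruct (Z.eq_dec q k) as [->|]; auto. apply Hq. lia.
Qed.

Lemma tau_pow_le (s : Z) : 1 <= s ->
  exists C, 0 < C /\ forall n, 0 < n -> tau n ^ s <= C * n.
Proof.
  intros Hs. assert (Hss : 0 < s ^ s) by (apply Z.pow_pos_nonneg; lia).
  exists ((s ^ s) ^ Z.max 0 (2 ^ s - 2)). split; [apply Z.pow_pos_nonneg; lia|].
  intros n Hn. apply (tau_pow_le_aux s (Z.to_nat n)); auto; lia.
Qed.

End Divisors.

(** * Representations by X^2 + d Y^2 *)

Section Representations.
Local Open Scope Z_scope.

(** Induction on the list of classes, removing the fibre over its head; the removal can only shrink
    the other fibres. *)
Lemma length_le_fibres {A : Type} (phi : A -> Z) (l : list A) (cl : list Z) (c : Z) :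
  (forall x, In x l -> In (phi x) cl) ->
  (forall b, In b cl -> Z.of_nat (length (filter (fun x => phi x =? b) l)) <= c) ->
  Z.of_nat (length l) <= c * Z.of_nat (length cl).
Proof.
  revert l. induction cl as [|b cl IH]; intros l Hin Hc.
  - destruct l as [|x l]; [cbn [length]; lia|]. destruct (Hin x). now left.
  - assert (H := IH (filter (fun x => negb (phi x =? b)) l)).
    assert (E := filter_length (fun x => phi x =? b) l).
    assert (Hb := Hc b (or_introl eq_refl)).
    cbn [length]. enough (Z.of_nat (length (filter (fun x => negb (phi x =? b)) l)) <=
      c * Z.of_nat (length cl)) by lia.
    apply H.
    + intros x Hx. apply filter_In in Hx as [Hx Hn].
      apply Bool.negb_true_iff, Z.eqb_neq in Hn.
      destruct (Hin x Hx) as [->|]; [lia | assumption].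
    + intros b' Hb'. etransitivity; [|apply (Hc b'); now right].
      apply inj_le. clear. induction l as [|x l IH]; simpl; [lia|].
      destruct (phi x =? b); simpl; destruct (phi x =? b'); simpl; lia.
Qed.

Definition is_rep (d K : Z) (z : Z * Z) : Prop :=
  fst z * fst z + d * snd z * snd z = K.

(** Modulo [Y] the represented number is X^2. *)
Lemma rel_prime_snd_rep (d X Y : Z) :
  rel_prime X Y -> rel_prime Y (X * X + d * Y * Y).
Proof.
  intros H. apply rel_prime_sym in H.
  assert (H2 : rel_prime Y (X * X)) by (apply rel_prime_mult; auto).
  destruct (rel_prime_bezout _ _ H2) as [u v E].
  apply bezout_rel_prime. apply Bezout_intro with (u - v * d * Y) v. rewrite <- E. ring.
Qed.

(** Eliminating X^2 and X0^2 gives (X Y0 - X0 Y)(X Y0 + X0 Y) = K (Y0^2 - Y^2). Write K = g k; then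
    k divides the second factor. Thus X/Y is X0/Y0 modulo g and -X0/Y0 modulo k, and likewise for
    X1/Y1, so the determinant X Y1 - X1 Y is divisible by both g and k. *)
Lemma rep_quotient_dvd (d K X0 Y0 X1 Y1 X Y g : Z) : 0 < K ->
  X0 * X0 + d * Y0 * Y0 = K -> X1 * X1 + d * Y1 * Y1 = K -> X * X + d * Y * Y = K ->
  rel_prime Y0 K -> rel_prime Y K ->
  Z.gcd K (X * Y0 - X0 * Y) = g -> Z.gcd K (X1 * Y0 - X0 * Y1) = g ->
  (K | 2 * d * (X * Y1 - X1 * Y)).
Proof.
  intros HK E0 E1 E P0 P G G1.
  assert (cof : forall x y, x * x + d * y * y = K -> Z.gcd K (x * Y0 - X0 * y) = g ->
    exists k b, K = g * k /\ x * Y0 - X0 * y = g * b /\ (k | x * Y0 + X0 * y)).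
  { intros x y Exy Gxy.
    destruct (Z.gcd_divide_l K (x * Y0 - X0 * y)) as [k Ek].
    destruct (Z.gcd_divide_r K (x * Y0 - X0 * y)) as [b Eb].
    pose proof (Z.gcd_nonneg K (x * Y0 - X0 * y)) as Hg0.
    rewrite Gxy in *.
    assert (Hg : 0 < g) by (assert (g <> 0) by (intros Z0; rewrite Z0 in Ek; lia); lia).
    exists k, b. split; [lia|]. split; [lia|].
    assert (Hkb : Z.gcd k b = 1).
    { assert (T := Z.gcd_mul_mono_l_nonneg k b g Hg0).
      rewrite (Z.mul_comm g k), (Z.mul_comm g b), <- Ek, <- Eb, Gxy in T. nia. }
    apply Z.gauss with b; [|assumption].
    exists (Y0 * Y0 - y * y).
    apply Z.mul_reg_l with g; [lia|].
    transitivity ((x * Y0 - X0 * y) * (x * Y0 + X0 * y)); [rewrite Eb; ring|].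
    transitivity ((Y0 * Y0 - y * y) * K); [|rewrite Ek; ring].
    replace ((x * Y0 - X0 * y) * (x * Y0 + X0 * y))
      with ((x * x) * (Y0 * Y0) - (X0 * X0) * (y * y)) by ring.
    replace (x * x) with (K - d * y * y) by lia.
    replace (X0 * X0) with (K - d * Y0 * Y0) by lia. ring. }
  destruct (cof X Y E G) as (k & b & Ek & Eb & k1 & Ek1).
  destruct (cof X1 Y1 E1 G1) as (k' & b' & Ek' & Eb' & k2 & Ek2).
  assert (k' = k) as -> by (apply Z.mul_reg_l with g; [intros Z0; rewrite Z0 in Ek|]; lia).
  set (S := X * Y1 - X1 * Y).
  assert (HgS : (g | S)).
  { apply Gauss with Y0.
    - exists (b * Y1 - b' * Y). unfold S.
      transitivity ((X * Y0 - X0 * Y) * Y1 - (X1 * Y0 - X0 * Y1) * Y); [ring|].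
      rewrite Eb, Eb'. ring.
    - apply rel_prime_div with K; [apply rel_prime_sym; assumption | exists k; lia]. }
  assert (HkS : (k | S)).
  { apply Gauss with Y0.
    - exists (k1 * Y1 - k2 * Y). unfold S.
      transitivity ((X * Y0 + X0 * Y) * Y1 - (X1 * Y0 + X0 * Y1) * Y); [ring|].
      rewrite Ek1, Ek2. ring.
    - apply rel_prime_div with K; [apply rel_prime_sym; assumption | exists g; lia]. }
  (* The overlap of the two moduli. Modulo h both signs hold, so h divides 2X and then 2d; Bezout
     for g and k gives K | h S, whence the factor 2d of the conclusion. *)
  set (h := Z.gcd g k).
  assert (Hhg : (h | g)) by apply Z.gcd_divide_l.
  assert (Hhk : (h | k)) by apply Z.gcd_divide_r.
  assert (HhK : (h | K)) by (rewrite Ek; apply Z.divide_mul_l; assumption).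
  assert (Hh0 : rel_prime h Y0)
    by (apply rel_prime_div with K; [apply rel_prime_sym|]; assumption).
  assert (HhY : rel_prime h Y)
    by (apply rel_prime_div with K; [apply rel_prime_sym|]; assumption).
  assert (Hh2X : (h | 2 * X)).
  { apply Gauss with Y0; [|assumption].
    replace (Y0 * (2 * X)) with ((X * Y0 - X0 * Y) + (X * Y0 + X0 * Y)) by ring.
    apply Z.divide_add_r.
    - rewrite Eb. apply Z.divide_mul_l. assumption.
    - rewrite Ek1. apply Z.divide_mul_r. assumption. }
  assert (Hh2d : (h | 2 * d)).
  { apply Gauss with Y; [|assumption]. apply Gauss with Y; [|assumption].
    replace (Y * (Y * (2 * d))) with (2 * K - X * (2 * X)) by (rewrite <- E; ring).
    apply Z.divide_sub_r; apply Z.divide_mul_r; assumption. }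
  assert (HKh : (K | h * S)).
  { destruct (Z.gcd_bezout g k h eq_refl) as (u & v & Huv).
    rewrite <- Huv. destruct HgS as [s ES]. destruct HkS as [s' ES'].
    exists (u * s' + v * s).
    replace ((u * g + v * k) * S) with (u * g * S + v * k * S) by ring.
    rewrite ES' at 1. rewrite ES, Ek. ring. }
  destruct Hh2d as [t ->]. rewrite <- Z.mul_assoc. now apply Z.divide_mul_r.
Qed.

Definition zrange (n : Z) : list Z :=
  map (fun k => Z.of_nat k - n) (seq 0 (Z.to_nat (2 * n + 1))).

Lemma in_zrange (n x : Z) : - n <= x <= n -> In x (zrange n).
Proof.
  intros H. apply in_map_iff. exists (Z.to_nat (x + n)). split; [lia|].
  apply in_seq. lia.
Qed.

(** All members are compared with one of them, (X1, Y1), through (X + Y sqrt(-d)) (X1 - Y1 sqrt(-d))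
    = T - S sqrt(-d), of norm T^2 + d S^2 = K^2. As K | 2dS and |S| <= K, S is j K / (2d) with |j|
    <= 2d; this leaves 4d + 1 values of S, and T is determined up to sign. *)
Lemma primitive_fibre (d K X0 Y0 g : Z) (l : list (Z * Z)) : 1 <= d -> 0 < K ->
  is_rep d K (X0, Y0) -> rel_prime Y0 K -> NoDup l ->
  (forall z, In z l -> is_rep d K z /\ rel_prime (snd z) K /\
     Z.gcd K (fst z * Y0 - X0 * snd z) = g) ->
  Z.of_nat (length l) <= 8 * d + 2.
Proof.
  intros Hd HK E0 P0 Hnd Hl. unfold is_rep in *; simpl in E0.
  destruct l as [|[X1 Y1] l']; [cbn [length]; lia|]. set (l := (X1, Y1) :: l') in *.
  destruct (Hl (X1, Y1) (or_introl eq_refl)) as (E1 & P1 & G1); simpl in E1, P1, G1.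
  set (psi := fun z : Z * Z => (fst z * Y1 - X1 * snd z, fst z * X1 + d * snd z * Y1)).
  (* Rounded quotients and square roots yield spurious codes for some j; they do no harm, since the
     codes only have to contain every actual pair (S, T). *)
  set (root := fun j => Z.sqrt (K * K - d * (j * K / (2 * d)) * (j * K / (2 * d)))).
  set (codes := flat_map (fun j => [(j * K / (2 * d), root j); (j * K / (2 * d), - root j)])
                  (zrange (2 * d))).
  assert (Hlen : Z.of_nat (length codes) = 8 * d + 2).
  { unfold codes. rewrite (flat_map_constant_length (c := 2%nat)) by reflexivity.
    unfold zrange. rewrite length_map, length_seq. lia. }
  rewrite <- Hlen. apply inj_le.
  rewrite <- (length_map psi l). apply NoDup_incl_length.
  - apply Injective_map_NoDup_in; [|assumption].
    intros [X Y] [X' Y'] Hz Hz' Epsi.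
    injection Epsi as ES ET; simpl in ES, ET.
    (* Multiplying the product back by X1 + Y1 sqrt(-d) returns K (X + Y sqrt(-d)), so [psi] is
       injective. *)
    assert (HX : X * K = X' * K).
    { rewrite <- E1.
      transitivity ((X * X1 + d * Y * Y1) * X1 + d * Y1 * (X * Y1 - X1 * Y)); [ring|].
      rewrite ES, ET. ring. }
    assert (HY : Y * K = Y' * K).
    { rewrite <- E1.
      transitivity ((X * X1 + d * Y * Y1) * Y1 - X1 * (X * Y1 - X1 * Y)); [ring|].
      rewrite ES, ET. ring. }
    f_equal; apply Z.mul_reg_r with K; lia.
  - intros c Hc. apply in_map_iff in Hc as ([X Y] & <- & Hz).
    destruct (Hl _ Hz) as (E & P & G); simpl in E, P, G.
    destruct (rep_quotient_dvd d K X0 Y0 X1 Y1 X Y g) as [j Ej]; auto.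
    unfold psi; simpl.
    set (S := X * Y1 - X1 * Y) in *. set (T := X * X1 + d * Y * Y1).
    assert (Hn : T * T + d * S * S = K * K) by (unfold S, T; rewrite <- E at 1; rewrite <- E1; ring).
    assert (HS : - K <= S <= K) by nia.
    assert (Hj : j * K / (2 * d) = S) by (rewrite <- Ej, Z.mul_comm; apply Z.div_mul; lia).
    apply in_flat_map. exists j. split.
    + apply in_zrange. nia.
    + unfold root. rewrite Hj.
      replace (K * K - d * S * S) with (T * T) by lia.
      assert (Z.sqrt (T * T) = Z.abs T) as ->.
      { rewrite <- Z.abs_square. apply Z.sqrt_square. lia. }
      destruct (Z.abs_spec T) as [[_ ->]|[_ ->]]; [left; auto | right; left].
      f_equal. lia.
Qed.

Lemma primitive_reps (d K : Z) (l : list (Z * Z)) : 1 <= d -> 0 < K -> NoDup l ->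
  (forall z, In z l -> is_rep d K z /\ rel_prime (fst z) (snd z)) ->
  Z.of_nat (length l) <= (8 * d + 2) * tau K.
Proof.
  intros Hd HK Hnd Hl.
  destruct l as [|[X0 Y0] l']; [cbn [length]; unfold tau; nia|]. set (l := (X0, Y0) :: l') in *.
  assert (Hl' : forall z, In z l -> is_rep d K z /\ rel_prime (snd z) K).
  { intros z Hz. destruct (Hl z Hz) as [<- Hp]. split; [reflexivity|].
    now apply rel_prime_snd_rep. }
  destruct (Hl' (X0, Y0) (or_introl eq_refl)) as [E0 P0].
  apply (length_le_fibres (fun z => Z.gcd K (fst z * Y0 - X0 * snd z))).
  - intros z Hz. set (B := fst z * Y0 - X0 * snd z).
    pose proof (Z.gcd_divide_l K B) as Hdv. pose proof (Z.gcd_nonneg K B).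
    apply in_divs; [assumption|]. split; [|assumption].
    destruct Hdv as [k Ek].
    assert (Z.gcd K B <> 0) by (intros Z0; rewrite Z0 in Ek; lia). lia.
  - intros g _. apply (primitive_fibre d K X0 Y0 g); auto; [now apply NoDup_filter|].
    intros z Hz. apply filter_In in Hz as [Hz Hg]. apply Z.eqb_eq in Hg.
    destruct (Hl' z Hz). auto.
Qed.

(** Sorting by e = gcd(X, Y), which divides K: division by e turns the class into primitive
    representations of K / e^2, which has at most [tau K] divisors. One factor [tau K] counts the
    classes, the other bounds each class. *)
Lemma reps_le_tau (d K : Z) (l : list (Z * Z)) : 1 <= d -> 0 < K -> NoDup l ->
  (forall z, In z l -> is_rep d K z) ->
  Z.of_nat (length l) <= (8 * d + 2) * tau K * tau K.
Proof.
  intros Hd HK Hnd Hl. unfold is_rep in Hl.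
  assert (Hgcd : forall z, In z l -> let e := Z.gcd (fst z) (snd z) in
     0 < e /\ exists x y, fst z = e * x /\ snd z = e * y /\ rel_prime x y /\
       K = e * e * (x * x + d * y * y)).
  { intros [X Y] Hz e. specialize (Hl _ Hz). simpl in *.
    destruct (Z.gcd_divide_l X Y) as [x Ex]. destruct (Z.gcd_divide_r X Y) as [y Ey].
    fold e in Ex, Ey. pose proof (Z.gcd_nonneg X Y) as He0. fold e in He0.
    assert (He : 0 < e)
      by (assert (e <> 0) by (intros Z0; rewrite Z0, Z.mul_0_r in Ex, Ey; subst X Y; lia); lia). split; [assumption|].
    exists x, y. split; [lia|]. split; [lia|]. split.
    - apply Zgcd_1_rel_prime.
      assert (T := Z.gcd_mul_mono_l_nonneg x y e He0).
      rewrite (Z.mul_comm e x), (Z.mul_comm e y), <- Ex, <- Ey in T. fold e in T. nia.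
    - rewrite <- Hl. rewrite Ex, Ey. ring. }
  apply (length_le_fibres (fun z => Z.gcd (fst z) (snd z))).
  - intros z Hz. destruct (Hgcd z Hz) as (He & x & y & _ & _ & _ & E).
    apply in_divs; [assumption|]. split; [assumption|].
    rewrite E, <- Z.mul_assoc. apply Z.divide_factor_l.
  - intros e Hediv. apply in_divs in Hediv; [|assumption]. destruct Hediv as [He _].
    set (le := filter (fun z => Z.gcd (fst z) (snd z) =? e) l).
    assert (Hle : forall z, In z le -> exists x y, z = (e * x, e * y) /\ rel_prime x y /\
       K = e * e * (x * x + d * y * y)).
    { intros z Hz. apply filter_In in Hz as [Hz Hg]. apply Z.eqb_eq in Hg.
      destruct (Hgcd z Hz) as (_ & x & y & H1 & H2 & H3 & H4). rewrite Hg in *.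
      exists x, y. split; [destruct z; simpl in *; congruence | split; assumption]. }
    assert (Hndle : NoDup le) by now apply NoDup_filter.
    clearbody le.
    destruct le as [|z0 le0]; [cbn [length]; unfold tau; nia|]. set (le := z0 :: le0) in *.
    destruct (Hle z0) as (x0 & y0 & _ & _ & E0); [now left|].
    set (K1 := x0 * x0 + d * y0 * y0) in *.
    assert (HK1 : 0 < K1) by nia.
    transitivity ((8 * d + 2) * tau K1).
    + rewrite <- (length_map (fun z => (fst z / e, snd z / e)) le).
      apply primitive_reps; auto.
      * apply Injective_map_NoDup_in; [|assumption].
        intros z z' Hz Hz' Eq.
        destruct (Hle z Hz) as (x & y & -> & _). destruct (Hle z' Hz') as (x' & y' & -> & _).
        simpl in Eq. rewrite !(Z.mul_comm e), !Z.div_mul in Eq by lia.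
        injection Eq as -> ->. reflexivity.
      * intros z Hz. apply in_map_iff in Hz as (z' & <- & Hz').
        destruct (Hle z' Hz') as (x & y & -> & Hp & E). simpl.
        rewrite !(Z.mul_comm e), !Z.div_mul by lia. split; [|exact Hp].
        unfold is_rep; simpl. apply Z.mul_reg_l with (e * e); [nia|]. lia.
    + apply Z.mul_le_mono_nonneg_l; [lia|]. apply tau_divide; auto.
      exists (e * e). lia.
Qed.

(** This is the bound O(K^(1/s)) stated in integers. Since tau enters squared, the divisor bound is
    taken with exponent 2s. *)
Lemma reps_pow_le (d s : Z) : 1 <= d -> 1 <= s ->
  exists C, 0 < C /\ forall K l, 0 < K -> NoDup l -> (forall z, In z l -> is_rep d K z) ->
  Z.of_nat (length l) ^ s <= C * K.
Proof.
  intros Hd Hs. destruct (tau_pow_le (2 * s)) as (C & HC & Htau); [lia|].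
  exists ((8 * d + 2) ^ s * C). split.
  { apply Z.mul_pos_pos; [apply Z.pow_pos_nonneg; lia | assumption]. }
  intros K l HK Hnd Hl.
  apply Z.le_trans with (((8 * d + 2) * tau K * tau K) ^ s).
  - apply Z.pow_le_mono_l. split; [lia | now apply reps_le_tau].
  - rewrite <- Z.mul_assoc, Z.pow_mul_l, <- Z.mul_assoc, <- Z.pow_2_r, <- Z.pow_mul_r by lia.
    apply Z.mul_le_mono_nonneg_l; [apply Z.pow_nonneg; lia | now apply Htau].
Qed.

End Representations.

(** * Real powers *)

Lemma ln_le_sub_1 (x : R) : 0 < x -> ln x <= x - 1.
Proof.
  intros H. pose proof (exp_ineq1_le (ln x)) as E. rewrite exp_ln in E; lra.
Qed.

Lemma Rpower_pos (x y : R) : 0 < Rpower x y.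
Proof. apply exp_pos. Qed.

(** Weighted arithmetic-geometric mean inequality for x^p and 1: adding ln t <= t - 1 at t = u/A
    with weight 1 and at t = 1/A with weight p - 1 makes the right sides cancel, so ln x <= ln A. *)
Lemma Rpower_bernoulli (p x : R) : 1 <= p -> 0 < x -> 1 + p * (x - 1) <= Rpower x p.
Proof.
  intros Hp Hx. set (u := Rpower x p). assert (Hu : 0 < u) by apply Rpower_pos.
  assert (Hlu : ln u = p * ln x) by apply ln_exp.
  set (A := (u + (p - 1)) / p).
  assert (HA : 0 < A) by (apply Rdiv_lt_0_compat; lra).
  assert (E1 := ln_le_sub_1 (u / A) (Rdiv_lt_0_compat _ _ Hu HA)).
  assert (E2 := ln_le_sub_1 (/ A) (Rinv_0_lt_compat _ HA)).
  unfold Rdiv in E1. rewrite ln_mult in E1 by (auto; now apply Rinv_0_lt_compat).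
  rewrite ln_Rinv in E1, E2 by assumption.
  assert (E3 : u * / A + (p - 1) * / A = p) by (unfold A; field; lra).
  assert (E4 : (p - 1) * - ln A <= (p - 1) * (/ A - 1)) by (apply Rmult_le_compat_l; lra).
  assert (E5 : ln x <= ln A) by (apply Rmult_le_reg_l with p; lra).
  assert (E6 : x <= A).
  { destruct (Rle_lt_dec x A); auto. pose proof (ln_increasing A x HA r). lra. }
  assert (p * A = u + (p - 1)) by (unfold A; field; lra).
  assert (p * x <= p * A) by (apply Rmult_le_compat_l; lra). lra.
Qed.

(** Convexity of t^p: the graph lies above its tangent at y. This is Bernoulli's inequality at x/y,
    rescaled. *)
Lemma Rpower_tangent (p x y : R) : 1 <= p -> 0 < x -> 0 < y ->
  Rpower y p + p * Rpower y (p - 1) * (x - y) <= Rpower x p.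
Proof.
  intros Hp Hx Hy.
  assert (Hxy : 0 < x / y) by now apply Rdiv_lt_0_compat.
  assert (E := Rpower_bernoulli p (x / y) Hp Hxy).
  replace (Rpower x p) with (Rpower (x / y) p * Rpower y p).
  2:{ rewrite Rpower_mult_distr by assumption. f_equal. field. lra. }
  replace (Rpower y p) with (Rpower y (p - 1) * y).
  2:{ rewrite <- (Rpower_1 y) at 2 by assumption. rewrite <- Rpower_plus. f_equal. ring. }
  pose proof (Rpower_pos y (p - 1)).
  apply Rle_trans with ((1 + p * (x / y - 1)) * (Rpower y (p - 1) * y)).
  - right. field. lra.
  - apply Rmult_le_compat_r; [left; now apply Rmult_lt_0_compat | assumption].
Qed.

(** The tangent at x to the convex function t^(-d). It serves as a discrete substitute for
    integration when series are bounded by telescoping. *)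
Lemma Rpower_neg_tangent (d x y : R) : 0 < d -> 0 < x -> 0 < y ->
  Rpower x (- d) + d * Rpower x (- d - 1) * (x - y) <= Rpower y (- d).
Proof.
  intros Hd Hx Hy.
  assert (Hyx : 0 < y / x) by now apply Rdiv_lt_0_compat.
  replace (Rpower x (- d - 1)) with (Rpower x (- d) * / x).
  2:{ unfold Rminus. rewrite Rpower_plus. f_equal. rewrite Rpower_Ropp, Rpower_1; auto. }
  replace (Rpower y (- d)) with (Rpower x (- d) * Rpower (y / x) (- d)).
  2:{ rewrite Rpower_mult_distr by assumption. f_equal. field. lra. }
  assert (E : 1 + d * (1 - y / x) <= Rpower (y / x) (- d)).
  { unfold Rpower. pose proof (exp_ineq1_le (- d * ln (y / x))).
    pose proof (ln_le_sub_1 _ Hyx). nra. }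
  pose proof (Rpower_pos x (- d)).
  apply Rle_trans with (Rpower x (- d) * (1 + d * (1 - y / x))).
  - right. field. lra.
  - apply Rmult_le_compat_l; lra.
Qed.

Lemma Rpower_le_1_base (x y : R) : 1 <= x -> y <= 0 -> Rpower x y <= 1.
Proof.
  intros Hx Hy. rewrite <- (Rpower_O x) by lra. apply Rle_Rpower; lra.
Qed.

Lemma rpow_pos_eq (x y : R) : 0 < x -> rpow x y = Rpower x y.
Proof. intros H. unfold rpow. destruct Req_EM_T; [lra | reflexivity]. Qed.

Lemma rpow_0 (y : R) : rpow 0 y = 0.
Proof. unfold rpow. destruct Req_EM_T; [reflexivity | lra]. Qed.

Lemma rpow_nonneg (x y : R) : 0 <= rpow x y.
Proof.
  unfold rpow. destruct Req_EM_T; [lra | left; apply Rpower_pos].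
Qed.

Lemma rpow_le (x y p : R) : 0 <= p -> 0 <= x <= y -> rpow x p <= rpow y p.
Proof.
  intros Hp [[Hx|<-] Hy].
  - rewrite !rpow_pos_eq by lra. apply Rle_Rpower_l; lra.
  - rewrite rpow_0. apply rpow_nonneg.
Qed.

Lemma rpow_mult (x y p : R) : 0 <= x -> 0 <= y -> rpow (x * y) p = rpow x p * rpow y p.
Proof.
  intros [Hx|<-] [Hy|<-]; rewrite ?Rmult_0_l, ?Rmult_0_r, ?rpow_0; try ring.
  rewrite !rpow_pos_eq by (auto; now apply Rmult_lt_0_compat).
  now rewrite Rpower_mult_distr.
Qed.

Lemma rpow_rpow_inv (x p : R) : 0 <= x -> p <> 0 -> rpow (rpow x (/ p)) p = x.
Proof.
  intros [Hx|<-] Hp; [|now rewrite !rpow_0].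
  rewrite (rpow_pos_eq x) by assumption. rewrite rpow_pos_eq by apply Rpower_pos.
  rewrite Rpower_mult, Rinv_l, Rpower_1; auto.
Qed.

Lemma rpow_le_cancel (x y p : R) : 0 < p -> 0 <= x -> 0 <= y -> rpow x p <= rpow y p -> x <= y.
Proof.
  intros Hp Hx Hy H. destruct (Rle_lt_dec x y) as [|Hlt]; [assumption | exfalso].
  rewrite (rpow_pos_eq x) in H by lra. destruct Hy as [Hy|<-].
  - rewrite rpow_pos_eq in H by assumption.
    pose proof (Rlt_Rpower_l _ _ _ Hp (conj Hy Hlt)). lra.
  - rewrite rpow_0 in H. pose proof (Rpower_pos x p). lra.
Qed.

Lemma absZpow_eq (m : Z) (y : R) : m <> 0%Z -> absZpow m y = Rpower (IZR (Z.abs m)) y.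
Proof. intros H. apply rpow_pos_eq, IZR_lt. lia. Qed.

(** * Finite sums over lists *)

Definition lsum {A : Type} (g : A -> R) (l : list A) : R :=
  fold_right (fun x s => g x + s) 0 l.

Lemma lsum_app {A : Type} (g : A -> R) (l1 l2 : list A) :
  lsum g (l1 ++ l2) = lsum g l1 + lsum g l2.
Proof. induction l1 as [|x l1 IH]; simpl; [|rewrite IH]; ring. Qed.

Lemma lsum_le {A : Type} (g h : A -> R) (l : list A) :
  (forall x, In x l -> g x <= h x) -> lsum g l <= lsum h l.
Proof.
  induction l as [|x l IH]; simpl; intros H; [lra|].
  apply Rplus_le_compat; auto.
Qed.

Lemma lsum_ext {A : Type} (g h : A -> R) (l : list A) :
  (forall x, In x l -> g x = h x) -> lsum g l = lsum h l.
Proof.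
  intros H. apply Rle_antisym; apply lsum_le; intros x Hx; right; [|symmetry]; auto.
Qed.

Lemma lsum_nonneg {A : Type} (g : A -> R) (l : list A) :
  (forall x, In x l -> 0 <= g x) -> 0 <= lsum g l.
Proof.
  induction l as [|x l IH]; simpl; intros H; [lra|].
  apply Rplus_le_le_0_compat; auto.
Qed.

Lemma lsum_scal {A : Type} (c : R) (g : A -> R) (l : list A) :
  lsum (fun x => c * g x) l = c * lsum g l.
Proof. induction l as [|x l IH]; simpl; [|rewrite IH]; ring. Qed.

Lemma lsum_plus {A : Type} (g h : A -> R) (l : list A) :
  lsum (fun x => g x + h x) l = lsum g l + lsum h l.
Proof. induction l as [|x l IH]; simpl; [|rewrite IH]; ring. Qed.

Lemma lsum_const {A : Type} (c : R) (l : list A) :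
  lsum (fun _ => c) l = INR (length l) * c.
Proof.
  induction l as [|x l IH]; [simpl; ring|].
  cbn [length]. rewrite S_INR. simpl. rewrite IH. ring.
Qed.

Lemma lsum_map {A B : Type} (f : A -> B) (g : B -> R) (l : list A) :
  lsum g (map f l) = lsum (fun x => g (f x)) l.
Proof. induction l as [|x l IH]; simpl; [|rewrite IH]; reflexivity. Qed.

Lemma lsum_prod {A B : Type} (g : A -> B -> R) (l1 : list A) (l2 : list B) :
  lsum (fun x => lsum (g x) l2) l1 = lsum (fun z => g (fst z) (snd z)) (list_prod l1 l2).
Proof.
  induction l1 as [|x l1 IH]; simpl; [reflexivity|].
  now rewrite IH, lsum_app, lsum_map.
Qed.

Lemma lsum_filter {A : Type} (g : A -> R) (t : A -> bool) (l : list A) :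
  lsum g l = lsum g (filter t l) + lsum g (filter (fun x => negb (t x)) l).
Proof.
  induction l as [|x l IH]; simpl; [ring|].
  destruct (t x); simpl; rewrite IH; ring.
Qed.

Lemma lsum_incl {A : Type} (g : A -> R) (l1 l2 : list A) :
  (forall x, 0 <= g x) -> NoDup l1 -> incl l1 l2 -> lsum g l1 <= lsum g l2.
Proof.
  intros Hg. revert l2. induction l1 as [|x l1 IH]; intros l2 Hnd Hi.
  - apply lsum_nonneg; auto.
  - destruct (in_split x l2) as (u & v & ->); [apply Hi; now left|].
    inversion Hnd; subst.
    rewrite lsum_app. simpl.
    assert (E : lsum g l1 <= lsum g (u ++ v)).
    { apply IH; auto. intros y Hy.
      assert (Hy' := Hi y (or_intror Hy)). apply in_app_iff in Hy'. apply in_app_iff.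
      destruct Hy' as [|[->|]]; auto. contradiction. }
    rewrite lsum_app in E. lra.
Qed.

(** On the fibre over k the factor h is constant, so only the weights v are summed there, to at most
    c. *)
Lemma lsum_fibres_le {A : Type} (phi : A -> Z) (h : Z -> R) (v : A -> R) (c : R)
  (ks : list Z) (l : list A) :
  (forall k, 0 <= h k) -> (forall x, 0 <= v x) ->
  (forall x, In x l -> In (phi x) ks) ->
  (forall k, lsum v (filter (fun x => phi x =? k)%Z l) <= c) ->
  lsum (fun x => h (phi x) * v x) l <= c * lsum h ks.
Proof.
  intros Hh Hv. revert l. induction ks as [|k ks IH]; intros l Hin Hc.
  - destruct l as [|x l]; [simpl; lra|]. destruct (Hin x). now left.
  - rewrite (lsum_filter _ (fun x => phi x =? k)%Z l). simpl.
    rewrite Rmult_plus_distr_l. apply Rplus_le_compat.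
    + rewrite (lsum_ext _ (fun x => h k * v x)).
      * rewrite lsum_scal, Rmult_comm. apply Rmult_le_compat_r; auto.
      * intros x Hx. apply filter_In in Hx as [_ Hx]. apply Z.eqb_eq in Hx. now rewrite Hx.
    + apply IH.
      * intros x Hx. apply filter_In in Hx as [Hx Hn].
        apply Bool.negb_true_iff, Z.eqb_neq in Hn.
        destruct (Hin x Hx); [congruence | assumption].
      * intros k'. eapply Rle_trans; [|apply (Hc k')].
        clear - Hv. induction l as [|x l IHl]; simpl; [lra|].
        pose proof (Hv x).
        destruct (phi x =? k)%Z; simpl; destruct (phi x =? k')%Z; simpl; lra.
Qed.

(** * Symmetric intervals of integers as lists *)

Definition zr0 (N : nat) : list Z :=
  flat_map (fun k => [Z.of_nat (S k); (- Z.of_nat (S k))%Z]) (seq 0 N).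

Definition zr (N : nat) : list Z := 0%Z :: zr0 N.

Lemma sum_nat_lsum (g : nat -> R) (n : nat) : Defs.sum_nat g n = lsum g (seq 0 n).
Proof.
  induction n as [|n IH]; [reflexivity|].
  rewrite seq_S, lsum_app. simpl. rewrite IH. ring.
Qed.

Lemma sumZ0_lsum (N : nat) (g : Z -> R) : sumZ0 N g = lsum g (zr0 N).
Proof.
  unfold sumZ0, zr0. rewrite sum_nat_lsum.
  induction (seq 0 N) as [|k l IH]; [reflexivity|].
  cbn [flat_map app lsum fold_right]. cbn [lsum fold_right] in IH. unfold lsum in *. rewrite IH. ring.
Qed.

Lemma sumZ_lsum (N : nat) (g : Z -> R) : sumZ N g = lsum g (zr N).
Proof. unfold sumZ. fold (sumZ0 N g). now rewrite sumZ0_lsum. Qed.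

Lemma in_zr0 (N : nat) (x : Z) : In x (zr0 N) <-> x <> 0%Z /\ (Z.abs x <= Z.of_nat N)%Z.
Proof.
  unfold zr0. rewrite in_flat_map. split.
  - intros (k & Hk & Hx). apply in_seq in Hk. simpl in Hx.
    destruct Hx as [<-|[<-|[]]]; lia.
  - intros [H0 HN]. exists (Z.to_nat (Z.abs x - 1)). split; [apply in_seq; lia|].
    destruct (Z_lt_le_dec x 0); [right; left | left]; lia.
Qed.

Lemma in_zr (N : nat) (x : Z) : In x (zr N) <-> (Z.abs x <= Z.of_nat N)%Z.
Proof.
  unfold zr. simpl. rewrite in_zr0. destruct (Z.eq_dec x 0) as [->|]; simpl; lia.
Qed.

Lemma NoDup_zr0 (N : nat) : NoDup (zr0 N).
Proof.
  induction N as [|N IH]; [constructor|].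
  unfold zr0. rewrite seq_S, flat_map_app. fold (zr0 N).
  apply NoDup_app; auto.
  - simpl. repeat constructor; simpl; lia.
  - intros x Hx Hx'. apply in_zr0 in Hx. simpl in Hx'. lia.
Qed.

Lemma NoDup_zr (N : nat) : NoDup (zr N).
Proof.
  constructor; [|apply NoDup_zr0]. intros H. apply in_zr0 in H. lia.
Qed.

Lemma incl_zr (l : list Z) : exists N, incl l (zr N).
Proof.
  induction l as [|x l [N HN]].
  - exists 0%nat. intros x [].
  - exists (N + Z.to_nat (Z.abs x))%nat. intros y [->|Hy]; apply in_zr; [lia|].
    apply HN, in_zr in Hy. lia.
Qed.

Lemma NoDup_list_prod {A B : Type} (l1 : list A) (l2 : list B) :
  NoDup l1 -> NoDup l2 -> NoDup (list_prod l1 l2).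
Proof.
  intros H1 H2. induction l1 as [|x l1 IH]; simpl; [constructor|].
  inversion H1; subst. apply NoDup_app; auto.
  - apply Injective_map_NoDup; [intros y y'; congruence | assumption].
  - intros [u v] Hu Hv. apply in_map_iff in Hu as (y & E & _). injection E as -> ->.
    apply in_prod_iff in Hv. tauto.
Qed.

(** * Weighted representation sums *)

Lemma exists_argmin {A : Type} (f : A -> Z) (l : list A) :
  l <> [] -> exists x, In x l /\ forall y, In y l -> (f x <= f y)%Z.
Proof.
  induction l as [|x [|y l] IH]; intros H; [contradiction| |].
  - exists x. split; [now left|]. intros y [->|[]]. lia.
  - destruct IH as (z & Hz & Hmin); [discriminate|].
    destruct (Z_le_dec (f x) (f z)) as [Hle|Hle].
    + exists x. split; [now left|]. intros t [->|Ht]; [lia|]. specialize (Hmin t Ht). lia.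
    + exists z. split; [now right|]. intros t [->|Ht]; [lia|]. auto.
Qed.

(** A larger |Y| forces a smaller |X|, and then |X0| <= |X0| + |X| <= X0^2 - X^2 <= d Y^2. Hence K =
    X0^2 + d Y0^2 is at most t^2 + t <= 2 t^2 with t = d Y^2. *)
Lemma rep_small_bound (d K X0 Y0 X Y : Z) : (1 <= d)%Z ->
  is_rep d K (X0, Y0) -> is_rep d K (X, Y) -> (Z.abs Y0 < Z.abs Y)%Z ->
  (K <= 2 * d * d * (Z.abs Y ^ 4))%Z.
Proof.
  unfold is_rep; cbn [fst snd]. intros Hd E0 E H.
  assert (HY : (Y0 * Y0 < Y * Y)%Z) by nia.
  assert (HX : (X * X < X0 * X0)%Z) by nia.
  assert (HX2 : (Z.abs X0 <= d * (Y * Y))%Z).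
  { assert ((Z.abs X < Z.abs X0)%Z) by nia.
    assert ((Z.abs X0 + Z.abs X <= X0 * X0 - X * X)%Z) by nia. nia. }
  assert (HX3 : (X0 * X0 <= (d * (Y * Y)) * (d * (Y * Y)))%Z).
  { rewrite <- (Z.abs_square X0). apply Z.mul_le_mono_nonneg; lia. }
  replace (Z.abs Y ^ 4)%Z with ((Y * Y) * (Y * Y))%Z.
  2:{ rewrite <- (Z.abs_square Y). ring. }
  assert ((d * (Y0 * Y0) <= d * (Y * Y))%Z) by nia.
  assert ((1 <= Y * Y)%Z) by nia.
  replace (2 * d * d * (Y * Y * (Y * Y)))%Z with (2 * ((d * (Y * Y)) * (d * (Y * Y))))%Z by ring.
  assert ((1 <= d * (Y * Y))%Z) by nia.
  assert (E0' : K = (X0 * X0 + d * (Y0 * Y0))%Z) by lia.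
  clear - HX3 H0 H2 E0'. set (t := (d * (Y * Y))%Z) in *.
  assert ((t <= t * t)%Z) by nia. lia.
Qed.

Lemma Rpower_IZR_pow (L : Z) (s : nat) : (0 < L)%Z -> (1 <= s)%nat ->
  Rpower (IZR (L ^ Z.of_nat s)) (/ INR s) = IZR L.
Proof.
  intros HL Hs. rewrite <- pow_IZR, <- Rpower_pow by now apply IZR_lt.
  rewrite Rpower_mult, Rinv_r, Rpower_1; [reflexivity | now apply IZR_lt |].
  apply not_0_INR. lia.
Qed.

(* Apart from at most four solutions with minimal |Y|, all solutions of X^2 + d Y^2 = K
   satisfy |Y| >> K^(1/4), which beats the K^eps bound for their number. *)
Lemma rep_weight_sum (d : Z) (beta : R) : (1 <= d)%Z -> 0 < beta ->
  exists A, 0 <= A /\ forall K l, NoDup l ->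
    (forall z, In z l -> is_rep d K z /\ snd z <> 0%Z) ->
    lsum (fun z => Rpower (IZR (Z.abs (snd z))) (- beta)) l <= A.
Proof.
  intros Hd Hb.
  (* With s > 4/beta the counting bound (const |Y|^4)^(1/s) stays below a constant times
     |Y|^beta. *)
  destruct (INR_unbounded (4 / beta)) as [s Hs].
  assert (H4b : 0 < 4 / beta) by (apply Rdiv_lt_0_compat; lra).
  assert (Hs0 : 0 < INR s) by lra.
  assert (Hs1 : (1 <= s)%nat) by (apply (INR_lt 0) in Hs0; lia).
  destruct (reps_pow_le d (Z.of_nat s) Hd) as (C & HC & Hreps); [lia|].
  set (E := Rpower (IZR (2 * C * d * d)) (/ INR s)).
  assert (HE : 0 < E) by apply Rpower_pos.
  exists (4 + E). split; [lra|]. intros K l Hnd Hl.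
  set (w := fun z : Z * Z => Rpower (IZR (Z.abs (snd z))) (- beta)).
  assert (l = [] \/ l <> []) as [->|Hne] by (destruct l; [now left | right; discriminate]);
    [simpl; lra|].
  destruct (exists_argmin (fun z => Z.abs (snd z)) l Hne) as ([X0 Y0] & Hz0 & Hmin).
  destruct (Hl _ Hz0) as [E0 HY0]; simpl in HY0, Hmin.
  rewrite (lsum_filter w (fun z => Z.abs (snd z) =? Z.abs Y0)%Z l).
  set (l1 := filter (fun z => Z.abs (snd z) =? Z.abs Y0)%Z l).
  set (l2 := filter (fun z => negb (Z.abs (snd z) =? Z.abs Y0)%Z) l).
  apply Rplus_le_compat.
  (* Equal |Y| forces equal |X|, so only four sign choices remain; each weight is at most 1, whence
     the 4 in [4 + E]. *)
  - assert (Hlen : (length l1 <= length [(X0, Y0); (X0, - Y0); (- X0, Y0); (- X0, - Y0)]%Z)%nat).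
    { apply NoDup_incl_length; [now apply NoDup_filter|].
      intros [X Y] Hz. apply filter_In in Hz as [Hz Ha]. apply Z.eqb_eq in Ha. simpl in Ha.
      destruct (Hl _ Hz) as [E1 _]. unfold is_rep in E0, E1. simpl in E0, E1.
      assert (HYY : (Y * Y = Y0 * Y0)%Z) by (rewrite <- (Z.abs_square Y), Ha; apply Z.abs_square).
      assert (HXX : (X * X = X0 * X0)%Z) by nia.
      assert (HX : X = X0 \/ X = (- X0)%Z) by nia.
      assert (HY : Y = Y0 \/ Y = (- Y0)%Z) by lia.
      simpl. destruct HX as [-> | ->], HY as [-> | ->]; auto. }
    apply Rle_trans with (lsum (fun _ => 1) l1).
    + apply lsum_le. intros z Hz. apply filter_In in Hz as [Hz _].
      apply Rpower_le_1_base; [|lra]. apply IZR_le. destruct (Hl z Hz). lia.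
    + rewrite lsum_const. apply le_INR in Hlen. simpl in Hlen. lra.
  - destruct (Req_EM_T (INR (length l2)) 0) as [H0|H0].
    { assert (l2 = []) as -> by (apply length_zero_iff_nil, INR_eq; exact H0). simpl. lra. }
    assert (HKpos : (0 < K)%Z) by (destruct (Hl _ Hz0) as [<- _]; simpl; nia).
    assert (HL := Hreps K l HKpos Hnd (fun z Hz => proj1 (Hl z Hz))).
    assert (Hle : (length l2 <= length l)%nat) by apply filter_length_le.
    assert (Hl2 : 0 < INR (length l2)) by (pose proof (pos_INR (length l2)); lra).
    (* Each single weight is shown to be at most E divided by the number of terms, so the whole sum
       is at most E. *)
    apply Rle_trans with (lsum (fun _ => E / INR (length l2)) l2).
    2:{ rewrite lsum_const. right. field. lra. }
    apply lsum_le. intros [X Y] Hz. apply filter_In in Hz as [Hz Ha].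
    apply Bool.negb_true_iff, Z.eqb_neq in Ha. simpl in Ha.
    destruct (Hl _ Hz) as [E1 HY]. simpl in HY.
    assert (HK := rep_small_bound d K X0 Y0 X Y Hd E0 E1 ltac:(specialize (Hmin _ Hz); simpl in Hmin; lia)).
    assert (Hlp : (0 < Z.of_nat (length l2))%Z)
      by (assert (length l2 <> 0%nat) by (intros H1; rewrite H1 in H0; now apply H0); lia).
    assert (HL2 : (Z.of_nat (length l2) ^ Z.of_nat s <= (2 * C * d * d) * Z.abs Y ^ 4)%Z).
    { apply Z.le_trans with (Z.of_nat (length l) ^ Z.of_nat s)%Z; [apply Z.pow_le_mono_l; lia|].
      apply Z.le_trans with (1 := HL).
      replace (2 * C * d * d * Z.abs Y ^ 4)%Z with (C * (2 * d * d * Z.abs Y ^ 4))%Z by ring.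
      apply Z.mul_le_mono_nonneg_l; lia. }
    assert (HYp : 1 <= IZR (Z.abs Y)) by (apply IZR_le; lia).
    assert (HB : INR (length l2) <= E * Rpower (IZR (Z.abs Y)) beta).
    { rewrite INR_IZR_INZ, <- (Rpower_IZR_pow _ s Hlp Hs1).
      apply Rle_trans with (Rpower (IZR (2 * C * d * d * Z.abs Y ^ 4)) (/ INR s)).
      - apply Rle_Rpower_l; [left; now apply Rinv_0_lt_compat|].
        split; [apply IZR_lt, Z.pow_pos_nonneg; lia | now apply IZR_le].
      - rewrite mult_IZR, <- Rpower_mult_distr.
        + apply Rmult_le_compat_l; [lra|].
          change 4%Z with (Z.of_nat 4). rewrite <- pow_IZR, <- Rpower_pow, Rpower_mult by lra.
          apply Rle_Rpower; [assumption|]. simpl.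
          apply Rmult_le_reg_r with (INR s); [assumption|].
          apply Rmult_lt_compat_r with (r := beta) in Hs; [|assumption].
          unfold Rdiv in Hs. rewrite Rmult_assoc, Rinv_l in Hs by lra.
          rewrite Rmult_assoc, Rinv_l by lra. lra.
        + apply IZR_lt. nia.
        + apply IZR_lt, Z.pow_pos_nonneg; lia. }
    unfold w; simpl. rewrite Rpower_Ropp.
    pose proof (Rpower_pos (IZR (Z.abs Y)) beta) as Hw.
    apply Rmult_le_reg_r with (Rpower (IZR (Z.abs Y)) beta * INR (length l2));
      [now apply Rmult_lt_0_compat|].
    replace (/ Rpower (IZR (Z.abs Y)) beta * (Rpower (IZR (Z.abs Y)) beta * INR (length l2)))
      with (INR (length l2)) by (field; lra).
    replace (E / INR (length l2) * (Rpower (IZR (Z.abs Y)) beta * INR (length l2)))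
      with (E * Rpower (IZR (Z.abs Y)) beta) by (field; lra).
    assumption.
Qed.

(** Since c = 0 would make the discriminant a square, the substitution (n, m) -> (2cn + bm, m) is
    injective. It fixes m, hence the weights, and leads to a form depending on D alone; so A is
    uniform over all forms of discriminant D. *)
Lemma form_weight_sum (D : Z) (beta : R) : (D < 0)%Z -> 0 < beta ->
  exists A, 0 <= A /\ forall a b c k l, qdisc a b c = D -> NoDup l ->
    (forall z, In z l -> qform a b c (snd z) (fst z) = k /\ snd z <> 0%Z) ->
    lsum (fun z => Rpower (IZR (Z.abs (snd z))) (- beta)) l <= A.
Proof.
  intros HD Hb. destruct (rep_weight_sum (- D) beta) as (A & HA & H); [lia | assumption |].
  exists A. split; [assumption|]. unfold qdisc, qform. intros a b c k l ED Hnd Hl.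
  assert (Hc : c <> 0%Z) by (intros E; rewrite E, Z.mul_0_r in ED; pose proof (Z.square_nonneg b); lia).
  set (f := fun z : Z * Z => ((2 * c * fst z + b * snd z)%Z, snd z)).
  change (lsum (fun z => (fun y => Rpower (IZR (Z.abs (snd y))) (- beta)) (f z)) l <= A).
  rewrite <- lsum_map. apply (H (4 * c * k)%Z).
  - apply Injective_map_NoDup; [|assumption].
    intros [n m] [n' m'] E. unfold f in E; cbn [fst snd] in E. apply pair_equal_spec in E as [E1 ->].
    f_equal. assert ((2 * c * n = 2 * c * n')%Z) as E2 by lia.
    apply Z.mul_reg_l in E2; [assumption | lia].
  - intros z' Hz. apply in_map_iff in Hz as ([n m] & <- & Hz).
    destruct (Hl _ Hz) as [<- Hm]. split; [|exact Hm].
    unfold is_rep, f; cbn [fst snd]. rewrite <- ED. ring.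
Qed.

(** * Summable weights and the weighted power mean inequality *)

Lemma p_series_bound (sigma : R) (M : nat) : 1 < sigma ->
  Defs.sum_nat (fun k => Rpower (INR (S k)) (- sigma)) M <= 1 + / (sigma - 1).
Proof.
  intros Hs. set (d := sigma - 1). assert (Hd : 0 < d) by (unfold d; lra).
  assert (Hid := Rinv_0_lt_compat _ Hd).
  destruct M as [|M]; [simpl; lra|].
  (* The induction carries the subtracted tail: the tangent at k + 1 gives (k+1)^(-sigma) <= (k^(-d)
     - (k+1)^(-d)) / d, which telescopes. *)
  enough (H : Defs.sum_nat (fun k => Rpower (INR (S k)) (- sigma)) (S M) <=
    1 + / d * (1 - Rpower (INR (S M)) (- d))).
  { pose proof (Rpower_pos (INR (S M)) (- d)). nra. }
  induction M as [|M IH].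
  - simpl. unfold Rpower. rewrite ln_1, !Rmult_0_r, exp_0. lra.
  - cbn [Defs.sum_nat] in *.
    assert (HM : 0 < INR (S M)) by (apply lt_0_INR; lia).
    assert (T := Rpower_neg_tangent d (INR (S (S M))) (INR (S M)) Hd ltac:(apply lt_0_INR; lia) HM).
    replace (- d - 1) with (- sigma) in T by (unfold d; ring).
    replace (INR (S (S M)) - INR (S M)) with 1 in T by (rewrite (S_INR (S M)); ring).
    apply Rmult_le_compat_l with (r := / d) in T; [|lra].
    replace (/ d * (Rpower (INR (S (S M))) (- d) + d * Rpower (INR (S (S M))) (- sigma) * 1))
      with (/ d * Rpower (INR (S (S M))) (- d) + Rpower (INR (S (S M))) (- sigma)) in T
      by (field; lra).
    lra.
Qed.

Lemma abs_weight_sum (sigma : R) : 1 < sigma ->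
  exists W, 0 < W /\ forall M, lsum (fun m => Rpower (IZR (Z.abs m)) (- sigma)) (zr0 M) <= W.
Proof.
  intros Hs. exists (2 * (1 + / (sigma - 1))).
  assert (0 < / (sigma - 1)) by (apply Rinv_0_lt_compat; lra).
  split; [lra|]. intros M. rewrite <- sumZ0_lsum. unfold sumZ0.
  apply Rle_trans with (2 * Defs.sum_nat (fun k => Rpower (INR (S k)) (- sigma)) M).
  - right. rewrite !sum_nat_lsum, <- lsum_scal. apply lsum_ext. intros k _.
    rewrite Z.abs_opp, !Z.abs_eq, <- INR_IZR_INZ by lia. ring.
  - apply Rmult_le_compat_l; [lra | now apply p_series_bound].
Qed.

(** Jensen's inequality without normalised weights: the tangent inequality for t^p at y = s/W is
    summed against w. The missing mass W - sum w enters with the factor p >= 1, so W may replace the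
    true total weight. *)
Lemma weighted_power_mean {A : Type} (p W : R) (w x : A -> R) (l : list A) :
  1 <= p -> 0 < W -> (forall m, In m l -> 0 <= w m /\ 0 <= x m) -> lsum w l <= W ->
  rpow (lsum (fun m => w m * x m) l) p <= Rpower W (p - 1) * lsum (fun m => w m * rpow (x m) p) l.
Proof.
  intros Hp HW Hwx HlW. set (s := lsum (fun m => w m * x m) l).
  assert (Hs : 0 <= s).
  { apply lsum_nonneg. intros m Hm. destruct (Hwx m Hm). now apply Rmult_le_pos. }
  assert (HR : 0 <= lsum (fun m => w m * rpow (x m) p) l).
  { apply lsum_nonneg. intros m Hm. destruct (Hwx m Hm).
    apply Rmult_le_pos; [assumption | apply rpow_nonneg]. }
  destruct Hs as [Hs|Hs].
  2:{ rewrite <- Hs, rpow_0. apply Rmult_le_pos; [left; apply Rpower_pos | assumption]. }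
  set (y := s / W). assert (Hy : 0 < y) by now apply Rdiv_lt_0_compat.
  assert (Hyp : Rpower y p = Rpower y (p - 1) * y).
  { rewrite <- (Rpower_1 y) at 3 by assumption. rewrite <- Rpower_plus. f_equal. ring. }
  pose proof (Rpower_pos y (p - 1)) as Hq. pose proof (Rpower_pos y p) as Hq'.
  assert (Htan : forall t, 0 <= t ->
    Rpower y p + p * Rpower y (p - 1) * (t - y) <= rpow t p).
  { intros t [Ht|<-].
    - rewrite rpow_pos_eq by assumption. now apply Rpower_tangent.
    - rewrite rpow_0, Hyp. nra. }
  assert (Hsum : Rpower y p * lsum w l + p * Rpower y (p - 1) * (s - y * lsum w l) <=
    lsum (fun m => w m * rpow (x m) p) l).
  { apply Rle_trans with
      (lsum (fun m => w m * (Rpower y p + p * Rpower y (p - 1) * (x m - y))) l).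
    - right. unfold s. rewrite (lsum_ext (fun m => w m * (Rpower y p + p * Rpower y (p - 1) * (x m - y)))
        (fun m => (Rpower y p - p * Rpower y (p - 1) * y) * w m
                  + p * Rpower y (p - 1) * (w m * x m))) by (intros; ring).
      rewrite lsum_plus, !lsum_scal. ring.
    - apply lsum_le. intros m Hm. destruct (Hwx m Hm).
      apply Rmult_le_compat_l; auto. }
  assert (Hsy : s = y * W) by (unfold y; field; lra).
  assert (Hfin : Rpower y p * W <= lsum (fun m => w m * rpow (x m) p) l).
  { apply Rle_trans with (2 := Hsum). rewrite Hsy, Hyp.
    set (u := Rpower y (p - 1) * y). assert (0 <= u) by (unfold u; nra).
    replace (p * Rpower y (p - 1) * (y * W - y * lsum w l)) with (p * u * (W - lsum w l))
      by (unfold u; ring).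
    assert (1 * (u * (W - lsum w l)) <= p * (u * (W - lsum w l)))
      by (apply Rmult_le_compat_r; [apply Rmult_le_pos|]; lra).
    lra. }
  rewrite rpow_pos_eq by assumption. rewrite Hsy, <- Rpower_mult_distr by assumption.
  replace (Rpower W p) with (Rpower W (p - 1) * W).
  2:{ rewrite <- (Rpower_1 W) at 2 by assumption. rewrite <- Rpower_plus. f_equal. ring. }
  pose proof (Rpower_pos W (p - 1)). nra.
Qed.

(** * Boundedness *)

Lemma sumZ0_le (N : nat) (g h : Z -> R) :
  (forall m, m <> 0%Z -> g m <= h m) -> sumZ0 N g <= sumZ0 N h.
Proof.
  intros H. rewrite !sumZ0_lsum. apply lsum_le. intros m Hm. apply in_zr0 in Hm.
  apply H. tauto.
Qed.

Lemma sumZ0_nonneg (N : nat) (g : Z -> R) : (forall m, 0 <= g m) -> 0 <= sumZ0 N g.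
Proof. intros H. rewrite sumZ0_lsum. apply lsum_nonneg. auto. Qed.

Lemma sumZ0_nonneg_cv (h : Z -> R) (L : R) :
  (forall m, 0 <= h m) -> (forall M, sumZ0 M h <= L) ->
  exists H, Un_cv (fun M => sumZ0 M h) H.
Proof.
  intros Hh HL. destruct (growing_cv (fun M => sumZ0 M h)) as [H HH].
  - intros M. unfold sumZ0. cbn [Defs.sum_nat].
    pose proof (Hh (Z.of_nat (S M))). pose proof (Hh (- Z.of_nat (S M))%Z). lra.
  - exists L. intros x [M ->]. apply HL.
  - now exists H.
Qed.

(** The terms g + h are nonnegative with partial sums at most 2L, so their sums converge
    monotonically; subtracting the sums of h gives the limit for g. *)
Lemma sumZ0_dominated_cv (g h : Z -> R) (L H : R) :
  (forall m, Rabs (g m) <= h m) -> (forall M, sumZ0 M h <= L) ->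
  Un_cv (fun M => sumZ0 M h) H ->
  exists l, Un_cv (fun M => sumZ0 M g) l /\ Rabs l <= H.
Proof.
  intros Hg HL HH.
  assert (Hgh : forall m, - h m <= g m <= h m).
  { intros m. specialize (Hg m).
    pose proof (Rle_abs (g m)). pose proof (Rle_abs (- g m)). rewrite Rabs_Ropp in *. lra. }
  assert (Hplus : forall M, sumZ0 M (fun m => g m + h m) = sumZ0 M g + sumZ0 M h).
  { intros M. rewrite !sumZ0_lsum. apply lsum_plus. }
  destruct (sumZ0_nonneg_cv (fun m => g m + h m) (L + L)) as [l1 Hl1].
  - intros m. specialize (Hgh m). lra.
  - intros M. rewrite Hplus. apply Rplus_le_compat; [|apply HL].
    eapply Rle_trans; [|apply (HL M)]. apply sumZ0_le. intros m _. apply Hgh.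
  - assert (Hl : Un_cv (fun M => sumZ0 M g) (l1 - H)).
    { intros eps Heps. destruct (CV_minus _ _ _ _ Hl1 HH eps Heps) as [N0 HN0].
      exists N0. intros M HM. specialize (HN0 M HM). rewrite Hplus in HN0.
      replace (sumZ0 M g) with (sumZ0 M g + sumZ0 M h - sumZ0 M h) by ring. exact HN0. }
    exists (l1 - H). split; [exact Hl|]. apply Rabs_le. split.
    + apply (Rle_cv_lim (Un := fun M => - sumZ0 M h) (Vn := fun M => sumZ0 M g)); auto.
      * intros M. rewrite !sumZ0_lsum.
        replace (- lsum h (zr0 M)) with (lsum (fun m => -1 * h m) (zr0 M))
          by (rewrite lsum_scal; ring).
        apply lsum_le. intros m _. specialize (Hgh m). lra.
      * now apply CV_opp.
    + apply (Rle_cv_lim (Un := fun M => sumZ0 M g) (Vn := fun M => sumZ0 M h)); auto.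
      intros M. apply sumZ0_le. intros m _. apply Hgh.
Qed.

Lemma Cmod_ge (z : Cx) : Rabs (fst z) <= Cmod z /\ Rabs (snd z) <= Cmod z.
Proof.
  unfold Cmod. split; rewrite <- sqrt_Rsqr_abs; apply sqrt_le_1_alt; unfold Rsqr;
    pose proof (Rle_0_sqr (fst z)); pose proof (Rle_0_sqr (snd z)); unfold Rsqr in *; lra.
Qed.

Lemma Cmod_le (z : Cx) : Cmod z <= Rabs (fst z) + Rabs (snd z).
Proof.
  pose proof (Rabs_pos (fst z)). pose proof (Rabs_pos (snd z)).
  unfold Cmod. rewrite <- (sqrt_square (Rabs (fst z) + Rabs (snd z))) by lra.
  apply sqrt_le_1_alt.
  pose proof (Rsqr_abs (fst z)). pose proof (Rsqr_abs (snd z)). unfold Rsqr in *. nra.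
Qed.

Lemma Cmod_nonneg (z : Cx) : 0 <= Cmod z.
Proof. apply sqrt_pos. Qed.

Definition majorant (a b c : Z) (lam : R) (f : Z -> Cx) (M : nat) (n : Z) : R :=
  sumZ0 M (fun m => Cmod (f (qform a b c m n)) / absZpow m lam).

Lemma absZpow_inv_nonneg (m : Z) (y : R) : 0 <= / absZpow m y.
Proof.
  destruct (rpow_nonneg (IZR (Z.abs m)) y) as [H|H]; unfold absZpow.
  - left. now apply Rinv_0_lt_compat.
  - rewrite <- H, Rinv_0. lra.
Qed.

Lemma majorant_nonneg (a b c : Z) (lam : R) (f : Z -> Cx) (M : nat) (n : Z) :
  0 <= majorant a b c lam f M n.
Proof.
  apply sumZ0_nonneg. intros m.
  apply Rmult_le_pos; [apply Cmod_nonneg | apply absZpow_inv_nonneg].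
Qed.

(* The factor 4 absorbs both the passage from the complex modulus to real and imaginary
   parts and the passage from the limit to a partial sum. *)
Lemma I_converges (a b c : Z) (lam : R) (f : Z -> Cx) (n : Z) (L : R) :
  (forall M, majorant a b c lam f M n <= L) ->
  exists F, I_converges_to a b c lam f n F /\
    exists M0, forall M, (M0 <= M)%nat -> Cmod F <= 4 * majorant a b c lam f M n.
Proof.
  intros HL. set (h := fun m => Cmod (f (qform a b c m n)) / absZpow m lam).
  assert (Hdom : forall m x, Rabs x <= Cmod (f (qform a b c m n)) ->
    Rabs (x / absZpow m lam) <= h m).
  { intros m x Hx. unfold h, Rdiv.
    rewrite Rabs_mult, (Rabs_pos_eq (/ _)) by apply absZpow_inv_nonneg.
    apply Rmult_le_compat_r; [apply absZpow_inv_nonneg | exact Hx]. }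
  destruct (sumZ0_nonneg_cv h L) as [H HH].
  { intros m. apply Rmult_le_pos; [apply Cmod_nonneg | apply absZpow_inv_nonneg]. }
  { exact HL. }
  destruct (sumZ0_dominated_cv (fun m => fst (f (qform a b c m n)) / absZpow m lam) h L H)
    as (x & Hx & Hxa); auto.
  { intros m. apply Hdom, Cmod_ge. }
  destruct (sumZ0_dominated_cv (fun m => snd (f (qform a b c m n)) / absZpow m lam) h L H)
    as (y & Hy & Hya); auto.
  { intros m. apply Hdom, Cmod_ge. }
  exists (x, y). split; [now split|].
  assert (HF : Cmod (x, y) <= 2 * H).
  { pose proof (Cmod_le (x, y)) as T. simpl in T. lra. }
  destruct (Rle_lt_dec H 0) as [H0|H0].
  - exists 0%nat. intros M _. pose proof (majorant_nonneg a b c lam f M n). lra.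
  - destruct (HH (H / 2)) as [M0 HM0]; [lra|]. exists M0. intros M HM.
    specialize (HM0 M HM). unfold R_dist in HM0. apply Rabs_def2 in HM0.
    change (sumZ0 M h) with (majorant a b c lam f M n) in HM0. lra.
Qed.

Lemma I_converges_all (a b c : Z) (lam : R) (f : Z -> Cx) (L : R) :
  (forall M n, majorant a b c lam f M n <= L) ->
  exists F : Z -> Cx, (forall n, I_converges_to a b c lam f n (F n)) /\
    forall n, exists M0, forall M, (M0 <= M)%nat -> Cmod (F n) <= 4 * majorant a b c lam f M n.
Proof.
  intros HL.
  pose (F := fun n => constructive_indefinite_description _
                        (I_converges a b c lam f n L (fun M => HL M n))).
  exists (fun n => proj1_sig (F n)).
  split; intros n; apply (proj2_sig (F n)).
Qed.

(** Splitting |m|^(-lam) = |m|^(-sigma) |m|^(sigma - lam) and applying the power mean with weights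
    |m|^(-sigma) leaves |f|^p against |m|^(-sigma + p (sigma - lam)) = |m|^(-beta). The sum over the
    box is then regrouped by the value of the form. *)
Lemma majorant_lp_bound (p lam : R) (D : Z) : 1 <= p -> 1 - / p < lam -> (D < 0)%Z ->
  exists E, 0 <= E /\ forall a b c f B, qdisc a b c = D -> lp_bounded p f B ->
    forall M N, sumZ N (fun n => rpow (majorant a b c lam f M n) p) <= E * rpow B p.
Proof.
  intros Hp Hlam HD.
  assert (Hpl : 0 < p * lam - (p - 1)).
  { apply Rmult_lt_compat_l with (r := p) in Hlam; [|lra].
    rewrite Rmult_minus_distr_l, Rinv_r in Hlam by lra. lra. }
  (* At sigma = 1 the exponent beta would be p lam - (p-1) > 0. Raising sigma by this amount over 2p
     makes the weights summable and keeps the fraction (p+1)/(2p) of beta. *)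
  set (sigma := 1 + (p * lam - (p - 1)) / (2 * p)).
  assert (Hs : 1 < sigma).
  { assert (0 < (p * lam - (p - 1)) / (2 * p)) by (apply Rdiv_lt_0_compat; lra).
    unfold sigma. lra. }
  set (beta := p * lam - (p - 1) * sigma).
  assert (Hb : 0 < beta).
  { unfold beta, sigma.
    replace (p * lam - (p - 1) * (1 + (p * lam - (p - 1)) / (2 * p)))
      with ((p * lam - (p - 1)) * ((p + 1) / (2 * p))) by (field; lra).
    apply Rmult_lt_0_compat; [assumption|]. apply Rdiv_lt_0_compat; lra. }
  destruct (abs_weight_sum sigma Hs) as (W & HW & HWs).
  destruct (form_weight_sum D beta HD Hb) as (A & HA & HAs).
  exists (Rpower W (p - 1) * A). split.
  { apply Rmult_le_pos; [left; apply Rpower_pos | assumption]. }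
  intros a b c f B Hdisc Hf M N.
  set (h := fun k => rpow (Cmod (f k)) p).
  set (v := fun z : Z * Z => Rpower (IZR (Z.abs (snd z))) (- beta)).
  set (phi := fun z : Z * Z => qform a b c (snd z) (fst z)).
  set (box := list_prod (zr N) (zr0 M)).
  rewrite sumZ_lsum.
  assert (Hrow : forall n, rpow (majorant a b c lam f M n) p <=
    Rpower W (p - 1) * lsum (fun m => h (phi (n, m)) * v (n, m)) (zr0 M)).
  { intros n.
    set (w := fun m => Rpower (IZR (Z.abs m)) (- sigma)).
    set (x := fun m => Cmod (f (qform a b c m n)) * Rpower (IZR (Z.abs m)) (sigma - lam)).
    assert (Hpos : forall m, 0 <= w m /\ 0 <= x m).
    { intros m. split; [left; apply Rpower_pos|].
      apply Rmult_le_pos; [apply Cmod_nonneg | left; apply Rpower_pos]. }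
    unfold majorant. rewrite sumZ0_lsum.
    rewrite (lsum_ext _ (fun m => w m * x m)).
    - rewrite (lsum_ext (fun m => h (phi (n, m)) * v (n, m)) (fun m => w m * rpow (x m) p)).
      + apply weighted_power_mean; auto.
      + intros m Hm. unfold h, phi, v, w, x. simpl.
        rewrite rpow_mult by (try apply Cmod_nonneg; left; apply Rpower_pos).
        rewrite (rpow_pos_eq (Rpower _ _)) by apply Rpower_pos. rewrite Rpower_mult.
        replace (- beta) with (- sigma + (sigma - lam) * p) by (unfold beta; ring).
        rewrite Rpower_plus. ring.
    - intros m Hm. apply in_zr0 in Hm. rewrite absZpow_eq by tauto. unfold w, x, Rdiv.
      rewrite <- Rpower_Ropp.
      replace (- lam) with (- sigma + (sigma - lam)) by ring. rewrite Rpower_plus. ring. }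
  apply Rle_trans with (Rpower W (p - 1) * lsum (fun z => h (phi z) * v z) box).
  { apply Rle_trans with (1 := lsum_le _ _ _ (fun n _ => Hrow n)).
    rewrite lsum_scal, lsum_prod. apply Rmult_le_compat_l; [left; apply Rpower_pos|].
    right. apply lsum_ext. intros [n m] _. reflexivity. }
  rewrite Rmult_assoc. apply Rmult_le_compat_l; [left; apply Rpower_pos|].
  (* A finite interval containing every value of the form on the box, so that the bound on partial
     sums of |f|^p applies. *)
  destruct (incl_zr (map phi box)) as [K0 HK0].
  apply Rle_trans with (A * lsum h (zr K0)).
  - apply lsum_fibres_le.
    + intros k. apply rpow_nonneg.
    + intros z. left. apply Rpower_pos.
    + intros z Hz. apply HK0, in_map, Hz.
    + intros k. apply (HAs a b c k); [assumption | |].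
      * apply NoDup_filter, NoDup_list_prod; [apply NoDup_zr | apply NoDup_zr0].
      * intros [n m] Hz. apply filter_In in Hz as [Hz Hk]. apply Z.eqb_eq in Hk.
        split; [exact Hk|]. apply in_prod_iff in Hz as [_ Hm]. apply in_zr0 in Hm. tauto.
  - apply Rmult_le_compat_l; [assumption|]. rewrite <- sumZ_lsum. apply Hf.
Qed.

(** The threshold at which a partial sum controls the limit varies with n; over a finite list the
    maximum of the thresholds serves all n at once. *)
Lemma eventually_lsum_le (g : Z -> R) (u : nat -> Z -> R) (l : list Z) :
  (forall n, exists M0, forall M, (M0 <= M)%nat -> g n <= u M n) ->
  exists M, lsum g l <= lsum (u M) l.
Proof.
  intros H. enough (exists M0, forall M, (M0 <= M)%nat -> lsum g l <= lsum (u M) l) as [M0 HM]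
    by (exists M0; auto).
  induction l as [|n l [M1 HM1]]; [exists 0%nat; intros; simpl; lra|].
  destruct (H n) as [M2 HM2]. exists (max M1 M2). intros M HM. simpl.
  apply Rplus_le_compat; [apply HM2 | apply HM1]; lia.
Qed.

Lemma lp_boundedness (p lam : R) (D : Z) : 1 <= p -> 1 - / p < lam -> (D < 0)%Z ->
  exists C : R, 0 <= C /\
   forall (a b c : Z), (qdisc a b c = D)%Z ->
   forall (f : Z -> Cx) (B : R), 0 <= B -> lp_bounded p f B ->
   exists F : Z -> Cx,
     (forall n : Z, I_converges_to a b c lam f n (F n)) /\
     lp_bounded p F (C * B).
Proof.
  intros Hp Hlam HD. destruct (majorant_lp_bound p lam D Hp Hlam HD) as (E & HE & Hmaj).
  (* The 4 comes from passing to the limit in [I_converges], and E^(1/p) is the operator bound for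
     the majorants. *)
  exists (4 * rpow E (/ p)). pose proof (rpow_nonneg E (/ p)) as HE'. split; [lra|].
  intros a b c Hdisc f B HB Hf.
  specialize (Hmaj a b c f B Hdisc Hf).
  assert (HEB : rpow (rpow E (/ p) * B) p = E * rpow B p).
  { rewrite rpow_mult, rpow_rpow_inv by (assumption || lra). reflexivity. }
  (* Convergence at each n requires a bound uniform in M, obtained by keeping only the term n of the
     sum over |k| <= |n|. *)
  destruct (I_converges_all a b c lam f (rpow E (/ p) * B)) as (F & HF & Hev).
  { intros M n. apply rpow_le_cancel with p; [lra | apply majorant_nonneg | now apply Rmult_le_pos |].
    rewrite HEB. eapply Rle_trans; [|apply (Hmaj M (Z.to_nat (Z.abs n)))].
    rewrite sumZ_lsum.
    replace (rpow (majorant a b c lam f M n) p)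
      with (lsum (fun n => rpow (majorant a b c lam f M n) p) [n]) by (simpl; ring).
    apply lsum_incl.
    - intros k. apply rpow_nonneg.
    - repeat constructor. simpl. tauto.
    - intros k [<-|[]]. apply in_zr. lia. }
  exists F. split; [exact HF|]. intros N.
  destruct (eventually_lsum_le (fun n => rpow (Cmod (F n)) p)
    (fun M n => rpow 4 p * rpow (majorant a b c lam f M n) p) (zr N)) as [M HM].
  { intros n. destruct (Hev n) as [M0 HM0]. exists M0. intros M HM.
    rewrite <- rpow_mult by (lra || apply majorant_nonneg).
    apply rpow_le; [lra|]. split; [apply Cmod_nonneg | auto]. }
  rewrite sumZ_lsum. apply Rle_trans with (1 := HM). rewrite lsum_scal.
  rewrite Rmult_assoc, (rpow_mult 4) by (lra || now apply Rmult_le_pos). rewrite HEB.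
  apply Rmult_le_compat_l; [apply rpow_nonneg|]. rewrite <- sumZ_lsum. apply Hmaj.
Qed.

(** Bounding |f| by [B] termwise leaves the convergent series of |m|^(-lam); the factor 4 is that of
    [I_converges]. *)
Lemma linf_boundedness (lam : R) : 1 < lam ->
  exists C : R, 0 <= C /\
   forall (a b c : Z) (f : Z -> Cx) (B : R), 0 <= B -> linf_bounded f B ->
   exists F : Z -> Cx,
     (forall n : Z, I_converges_to a b c lam f n (F n)) /\
     linf_bounded F (C * B).
Proof.
  intros Hlam. destruct (abs_weight_sum lam Hlam) as (W & HW & HWs).
  exists (4 * W). split; [lra|]. intros a b c f B HB Hf.
  assert (Hmaj : forall M n, majorant a b c lam f M n <= B * W).
  { intros M n. unfold majorant.
    apply Rle_trans with (B * lsum (fun m => Rpower (IZR (Z.abs m)) (- lam)) (zr0 M)).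
    - rewrite sumZ0_lsum, <- lsum_scal. apply lsum_le. intros m Hm. apply in_zr0 in Hm.
      rewrite absZpow_eq by tauto. unfold Rdiv. rewrite <- Rpower_Ropp.
      apply Rmult_le_compat_r; [left; apply Rpower_pos | apply Hf].
    - apply Rmult_le_compat_l; auto. }
  destruct (I_converges_all a b c lam f (B * W) Hmaj) as (F & HF & Hev).
  exists F. split; [exact HF|]. intros n. destruct (Hev n) as [M0 HM0].
  specialize (HM0 M0 (le_n _)). specialize (Hmaj M0 n). lra.
Qed.

(** * Numbers with many representations as a sum of two squares *)

Section GaussianIntegers.
Local Open Scope Z_scope.

Definition gmul (z w : Z * Z) : Z * Z :=
  (fst z * fst w - snd z * snd w, fst z * snd w + snd z * fst w).

Fixpoint gpow (z : Z * Z) (n : nat) : Z * Z :=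
  match n with
  | O => (1, 0)
  | S k => gmul (gpow z k) z
  end.

Definition gnorm (z : Z * Z) : Z := fst z * fst z + snd z * snd z.

Lemma gmul_comm (z w : Z * Z) : gmul z w = gmul w z.
Proof. unfold gmul. f_equal; ring. Qed.

Lemma gmul_assoc (z w v : Z * Z) : gmul z (gmul w v) = gmul (gmul z w) v.
Proof. unfold gmul; cbn [fst snd]. f_equal; ring. Qed.

Lemma gmul_1_r (z : Z * Z) : gmul z (1, 0) = z.
Proof. destruct z. unfold gmul; cbn [fst snd]. f_equal; ring. Qed.

Lemma gpow_add (z : Z * Z) (m n : nat) : gpow z (m + n) = gmul (gpow z m) (gpow z n).
Proof.
  rewrite Nat.add_comm. induction n as [|n IH]; simpl.
  - now rewrite gmul_1_r.
  - now rewrite IH, gmul_assoc.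
Qed.

Lemma gnorm_mul (z w : Z * Z) : gnorm (gmul z w) = gnorm z * gnorm w.
Proof. unfold gnorm, gmul; cbn [fst snd]. ring. Qed.

Lemma gnorm_pow (z : Z * Z) (n : nat) : gnorm (gpow z n) = gnorm z ^ Z.of_nat n.
Proof.
  induction n as [|n IH]; [reflexivity|].
  cbn [gpow]. rewrite gnorm_mul, IH, Nat2Z.inj_succ, Z.pow_succ_r by lia. ring.
Qed.

Lemma gmul_cancel_r (z z' w : Z * Z) : gnorm w <> 0 -> gmul z w = gmul z' w -> z = z'.
Proof.
  destruct z as [x y], z' as [x' y'], w as [u v]. unfold gnorm, gmul; cbn [fst snd].
  intros Hw E. apply pair_equal_spec in E as [E1 E2].
  assert (x * (u * u + v * v) = x' * (u * u + v * v)).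
  { transitivity ((x * u - y * v) * u + (x * v + y * u) * v); [ring|].
    rewrite E1, E2. ring. }
  assert (y * (u * u + v * v) = y' * (u * u + v * v)).
  { transitivity ((x * v + y * u) * u - (x * u - y * v) * v); [ring|].
    rewrite E1, E2. ring. }
  f_equal; eapply Z.mul_reg_r; eauto.
Qed.

(* With N = u^2 + 1, the map x + iy |-> x - uy is a ring morphism onto Z/N which kills u + i
   and sends u - i to 2u. *)
Definition gmod (u : Z) (z : Z * Z) : Z := fst z - u * snd z.

Lemma gmod_mul_pi (u : Z) (z : Z * Z) : (u * u + 1 | gmod u (gmul z (u, 1))).
Proof. exists (- snd z). unfold gmod, gmul; cbn [fst snd]. ring. Qed.

Lemma gmod_mul_pibar (u : Z) (z : Z * Z) : rel_prime (u * u + 1) (2 * u) ->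
  (u * u + 1 | gmod u (gmul z (u, -1))) -> (u * u + 1 | gmod u z).
Proof.
  intros Hu H. apply Gauss with (2 * u); [|assumption].
  replace (2 * u * gmod u z) with (gmod u (gmul z (u, -1)) + (u * u + 1) * - snd z)
    by (unfold gmod, gmul; cbn [fst snd]; ring).
  apply Z.divide_add_r; [assumption | apply Z.divide_factor_l].
Qed.

Lemma gmod_mul_pibar_pow (u : Z) (z : Z * Z) (n : nat) : rel_prime (u * u + 1) (2 * u) ->
  (u * u + 1 | gmod u (gmul z (gpow (u, -1) n))) -> (u * u + 1 | gmod u z).
Proof.
  intros Hu. induction n as [|n IH]; cbn [gpow]; [now rewrite gmul_1_r|].
  rewrite gmul_assoc. intros H. apply IH, gmod_mul_pibar; assumption.
Qed.

(** Multiplication by (u+i)^a (u-i)^(j-a), of norm (u^2+1)^j when a <= j; the choice of a gives j +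
    1 new representations for each old one. *)
Definition gtwist (u : Z) (j : nat) (za : (Z * Z) * nat) : Z * Z :=
  gmul (fst za) (gmul (gpow (u, 1) (snd za)) (gpow (u, -1) (j - snd za))).

(** Cancelling (u+i)^a (u-i)^(j-b) leaves z (u-i)^(b-a) = z' (u+i)^(b-a). The right side is killed
    by [gmod u], while u - i goes to a unit, so u^2 + 1 divides [gmod u z] and therefore the norm of
    z, contrary to coprimality. *)
Lemma gtwist_neq (u : Z) (j a b : nat) (z z' : Z * Z) :
  rel_prime (u * u + 1) (2 * u) -> 0 < u -> rel_prime (u * u + 1) (gnorm z) ->
  (a < b <= j)%nat -> gtwist u j (z, a) <> gtwist u j (z', b).
Proof.
  intros Hu Hu0 Hz Hab E. unfold gtwist in E; cbn [fst snd] in E.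
  set (c := (b - a - 1)%nat).
  replace (gpow (u, 1) b) with (gmul (gpow (u, 1) (S c)) (gpow (u, 1) a)) in E
    by (rewrite <- gpow_add; f_equal; lia).
  replace (gpow (u, -1) (j - a)) with (gmul (gpow (u, -1) (S c)) (gpow (u, -1) (j - b))) in E
    by (rewrite <- gpow_add; f_equal; lia).
  set (p := gpow (u, 1) a) in E. set (q := gpow (u, -1) (j - b)) in E.
  assert (E' : gmul (gmul z (gpow (u, -1) (S c))) (gmul p q) =
    gmul (gmul z' (gpow (u, 1) (S c))) (gmul p q)).
  { rewrite <- !gmul_assoc in *.
    rewrite (gmul_assoc p), (gmul_comm p), <- gmul_assoc in E. exact E. }
  apply gmul_cancel_r in E'.
  - assert (H : (u * u + 1 | gmod u z)).
    { apply (gmod_mul_pibar_pow u z (S c) Hu). rewrite E'. cbn [gpow].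
      rewrite gmul_assoc. apply gmod_mul_pi. }
    assert (H1 : (u * u + 1 | gnorm z)).
    { replace (gnorm z) with (gmod u z * (fst z + u * snd z) + (u * u + 1) * (snd z * snd z))
        by (unfold gmod, gnorm; ring).
      apply Z.divide_add_r; [now apply Z.divide_mul_l | apply Z.divide_factor_l]. }
    destruct Hz as [_ _ Hz]. specialize (Hz _ (Z.divide_refl _) H1).
    apply Z.divide_1_r in Hz. nia.
  - unfold p, q. rewrite gnorm_mul, !gnorm_pow. unfold gnorm; cbn [fst snd].
    assert (0 < u * u + 1 * 1) by nia. assert (0 < u * u + -1 * -1) by nia.
    pose proof (Z.pow_pos_nonneg (u * u + 1 * 1) (Z.of_nat a)).
    pose proof (Z.pow_pos_nonneg (u * u + -1 * -1) (Z.of_nat (j - b))). nia.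
Qed.

(** Parity is tracked to ensure that every representation has m odd, hence nonzero. *)
Lemma odd_gmul (z : Z * Z) (u v : Z) : Z.Even u -> Z.Odd v ->
  Z.Odd (fst z) /\ Z.Odd (snd z) ->
  Z.Odd (fst (gmul z (u, v))) /\ Z.Odd (snd (gmul z (u, v))).
Proof.
  intros [k ->] [l ->] [[m Em] [n En]]. unfold gmul; cbn [fst snd]. rewrite Em, En.
  split.
  - exists ((2 * m + 1) * k - (2 * n + 1) * l - n - 1). ring.
  - exists ((2 * n + 1) * k + (2 * m + 1) * l + m). ring.
Qed.

Lemma odd_gmul_gpow (z : Z * Z) (u v : Z) (n : nat) : Z.Even u -> Z.Odd v ->
  Z.Odd (fst z) /\ Z.Odd (snd z) ->
  Z.Odd (fst (gmul z (gpow (u, v) n))) /\ Z.Odd (snd (gmul z (gpow (u, v) n))).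
Proof.
  intros Hu Hv Hz. induction n as [|n IH]; cbn [gpow]; [now rewrite gmul_1_r|].
  rewrite gmul_assoc. now apply odd_gmul.
Qed.

(* Starting from 2 * 9^j = (3^j)^2 + (3^j)^2, each step multiplies P by u^2 + 1 with u = 2P,
   which is coprime to 2P, and the number of representations by j + 1. *)
Lemma many_reps (t : nat) : exists P, 2 <= P /\ forall j : nat, exists L : list (Z * Z),
  NoDup L /\ length L = ((j + 1) ^ t)%nat /\
  forall z, In z L -> gnorm z = 2 * P ^ Z.of_nat j /\ Z.Odd (fst z) /\ Z.Odd (snd z).
Proof.
  induction t as [|t (P & HP & IH)].
  - exists 9. split; [lia|]. intros j. exists [(3 ^ Z.of_nat j, 3 ^ Z.of_nat j)].
    split; [repeat constructor; simpl; tauto|]. split; [reflexivity|].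
    intros z [<-|[]]. unfold gnorm; cbn [fst snd]. split.
    + change 9 with (3 * 3). rewrite Z.pow_mul_l. ring.
    + assert (Z.Odd (3 ^ Z.of_nat j)); [|tauto].
      apply Z.odd_spec. induction j as [|j IHj]; [reflexivity|].
      rewrite Nat2Z.inj_succ, Z.pow_succ_r, Z.odd_mul, IHj by lia. reflexivity.
  - set (u := 2 * P). exists (P * (u * u + 1)). split; [nia|]. intros j.
    destruct (IH j) as (L & Hnd & Hlen & HL). clear IH.
    assert (Hru : rel_prime (u * u + 1) u)
      by (apply bezout_rel_prime, Bezout_intro with 1 (- u); ring).
    assert (Hr2 : rel_prime (u * u + 1) 2)
      by (apply bezout_rel_prime, Bezout_intro with 1 (- (P * u)); unfold u; ring).
    assert (HrP : rel_prime (u * u + 1) P)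
      by (apply bezout_rel_prime, Bezout_intro with 1 (- (2 * u)); unfold u; ring).
    assert (Hr2u : rel_prime (u * u + 1) (2 * u)) by (apply rel_prime_mult; assumption).
    assert (Hrz : forall z, In z L -> rel_prime (u * u + 1) (gnorm z)).
    { intros z Hz. destruct (HL z Hz) as [-> _].
      apply rel_prime_mult; [assumption | apply rel_prime_Zpower_r; [lia | assumption]]. }
    exists (map (gtwist u j) (list_prod L (seq 0 (S j)))). split; [|split].
    + apply Injective_map_NoDup_in; [|apply NoDup_list_prod; [assumption | apply seq_NoDup]].
      intros [z a] [z' b] Hz Hz' E.
      apply in_prod_iff in Hz as [Hz Ha]. apply in_prod_iff in Hz' as [Hz' Hb].
      apply in_seq in Ha. apply in_seq in Hb.
      destruct (Nat.lt_trichotomy a b) as [Hab|[<-|Hab]].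
      * exfalso. revert E. apply gtwist_neq; auto; lia.
      * f_equal. apply gmul_cancel_r in E; [exact E|].
        rewrite gnorm_mul, !gnorm_pow. unfold gnorm; cbn [fst snd].
        assert (0 < u * u + 1 * 1) by nia. assert (0 < u * u + -1 * -1) by nia.
        pose proof (Z.pow_pos_nonneg (u * u + 1 * 1) (Z.of_nat a)).
        pose proof (Z.pow_pos_nonneg (u * u + -1 * -1) (Z.of_nat (j - a))). nia.
      * exfalso. symmetry in E. revert E. apply gtwist_neq; auto; lia.
    + rewrite length_map, length_prod, length_seq, Hlen. simpl. lia.
    + intros z' Hz'. apply in_map_iff in Hz' as ([z a] & <- & Hz).
      apply in_prod_iff in Hz as [Hz Ha]. apply in_seq in Ha.
      destruct (HL z Hz) as [Hn Hodd]. unfold gtwist; cbn [fst snd]. split.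
      * rewrite !gnorm_mul, !gnorm_pow, Hn. unfold gnorm; cbn [fst snd].
        replace (u * u + -1 * -1) with (u * u + 1) by ring.
        replace (u * u + 1 * 1) with (u * u + 1) by ring.
        rewrite <- Z.pow_add_r by lia.
        replace (Z.of_nat a + Z.of_nat (j - a)) with (Z.of_nat j) by lia.
        rewrite Z.pow_mul_l. ring.
      * rewrite gmul_assoc. assert (Z.Even u) by (exists P; reflexivity).
        apply odd_gmul_gpow; [assumption | exists (-1); reflexivity |].
        apply odd_gmul_gpow; [assumption | exists 0; reflexivity | assumption].
Qed.

End GaussianIntegers.

(** * Sharpness *)

(** f takes the value [g i] at [phi i] and 0 off the image. Since [phi i >= i], the window |k| <= N
    meets only indices i <= N, so its sum is bounded by a partial sum over i. The function H allows
    both plain sums and p-th powers. *)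
Lemma pushforward (phi : nat -> Z) (g : nat -> R) :
  (forall i, (Z.of_nat i <= phi i)%Z) -> Injective phi -> (forall i, 0 <= g i) ->
  exists f : Z -> R, (forall k, 0 <= f k) /\ (forall i, f (phi i) = g i) /\
    forall (H : R -> R) (S : R), H 0 = 0 -> (forall x, 0 <= x -> 0 <= H x) ->
      (forall n, Defs.sum_nat (fun i => H (g i)) n <= S) ->
      forall N, sumZ N (fun k => H (f k)) <= S.
Proof.
  intros Hphi Hinj Hg.
  set (f := fun k => match excluded_middle_informative (exists i, phi i = k) with
    | left E => g (proj1_sig (constructive_indefinite_description _ E))
    | right _ => 0
    end).
  assert (Hf0 : forall k, 0 <= f k).
  { intros k. unfold f. destruct excluded_middle_informative; [apply Hg | lra]. }
  assert (Hfphi : forall i, f (phi i) = g i).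
  { intros i. unfold f. destruct excluded_middle_informative as [E|E].
    - f_equal. apply Hinj. apply (proj2_sig (constructive_indefinite_description _ E)).
    - destruct E. now exists i. }
  exists f. split; [assumption|]. split; [assumption|].
  intros H S H0 Hpos HS N. rewrite sumZ_lsum.
  set (t := fun k => if excluded_middle_informative (exists i, phi i = k) then true else false).
  rewrite (lsum_filter _ t).
  rewrite (lsum_ext _ (fun _ => 0) (filter (fun k => negb (t k)) _)).
  2:{ intros k Hk. apply filter_In in Hk as [_ Hk]. unfold t, f in *.
      destruct excluded_middle_informative; [discriminate | assumption]. }
  rewrite lsum_const, Rmult_0_r, Rplus_0_r.
  apply Rle_trans with (lsum (fun k => H (f k)) (map phi (seq 0 (N + 1)))).
  - apply lsum_incl.
    + intros k. apply Hpos, Hf0.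
    + apply NoDup_filter, NoDup_zr.
    + intros k Hk. apply filter_In in Hk as [Hk Ht]. unfold t in Ht.
      destruct excluded_middle_informative as [[i <-]|]; [|discriminate].
      apply in_map, in_seq. apply in_zr in Hk. specialize (Hphi i). lia.
  - rewrite lsum_map, (lsum_ext _ (fun i => H (g i))) by (intros i _; now rewrite Hfphi).
    rewrite <- sum_nat_lsum. apply HS.
Qed.

Lemma log_weight_inv_nonneg (m : Z) (r : nat) : 0 <= / ln (1 + IZR (Z.abs m)) ^ r.
Proof.
  assert (Hl : 0 <= ln (1 + IZR (Z.abs m))).
  { rewrite <- ln_1.
    destruct (Z.eq_dec m 0) as [->|Hm]; [simpl; rewrite Rplus_0_r; lra|].
    left. apply ln_increasing; [lra|]. assert (0 < IZR (Z.abs m)) by (apply IZR_lt; lia). lra. }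
  destruct (pow_le _ r Hl) as [H|H]; [left; now apply Rinv_0_lt_compat|].
  rewrite <- H, Rinv_0. lra.
Qed.

Lemma ln_le (x y : R) : 0 < x -> x <= y -> ln x <= ln y.
Proof. intros Hx [H| ->]; [left; now apply ln_increasing | lra]. Qed.

(** For the single value 2 P^j there are (j+1)^(r+3) representations, each contributing at least
    (j+1)^(-2) / ((j+1) c)^r. Their total (j+1) / c^r is unbounded in j. *)
Lemma sharpness_log (r : nat) :
   exists f : Z -> R, (forall k, 0 <= f k) /\
     (exists B : R, forall N : nat, sumZ N f <= B) /\
     (forall M : R, exists N : nat,
        M < sumZ N (fun n => sumZ0 N (fun m =>
              f (qform 1 0 1 m n) / (ln (1 + IZR (Z.abs m))) ^ r))).
Proof.
  destruct (many_reps (r + 3)) as (P & HP & Hreps).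
  set (phi := fun j => (2 * P ^ Z.of_nat j)%Z).
  set (g := fun j => Rpower (INR (S j)) (- (2))).
  assert (HPj : forall j, (Z.of_nat j < P ^ Z.of_nat j)%Z)
    by (intros j; apply Z.pow_gt_lin_r; lia).
  destruct (pushforward phi g) as (f & Hf0 & Hfphi & Hsum).
  { intros j. specialize (HPj j). unfold phi. lia. }
  { intros i j E. unfold phi in E. apply Z.mul_reg_l in E; [|lia].
    apply Z.pow_inj_r in E; lia. }
  { intros j. left. apply Rpower_pos. }
  exists f. split; [assumption|]. split.
  { exists (1 + / (2 - 1)).
    apply (Hsum (fun x => x)); auto. intros n. apply p_series_bound. lra. }
  intros M.
  (* Chosen so that 1 + |m| <= 1 + 2 P^j <= (3P)^(j+1) gives log(1 + |m|) <= (j+1) c. *)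
  set (c := ln (3 * IZR P)).
  assert (HPR : 2 <= IZR P) by now apply IZR_le.
  assert (Hc : 0 < c) by (unfold c; rewrite <- ln_1; apply ln_increasing; lra).
  assert (Hcr : 0 < c ^ r) by now apply pow_lt.
  destruct (INR_unbounded (M * c ^ r)) as [j Hj].
  destruct (Hreps j) as (L & Hnd & Hlen & HL).
  set (K := phi j). exists (Z.to_nat K).
  assert (HK : (0 < K)%Z) by (specialize (HPj j); unfold K, phi; lia).
  set (T := fun z : Z * Z => f (qform 1 0 1 (snd z) (fst z)) / ln (1 + IZR (Z.abs (snd z))) ^ r).
  rewrite sumZ_lsum.
  rewrite (lsum_ext _ (fun n => lsum (fun m => T (n, m)) (zr0 (Z.to_nat K))))
    by (intros n _; now rewrite sumZ0_lsum).
  rewrite lsum_prod.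
  apply Rlt_le_trans with (lsum T L).
  2:{ rewrite (lsum_ext _ T (list_prod _ _)) by (intros [n m] _; reflexivity).
      apply lsum_incl; [|assumption|].
      - intros z. apply Rmult_le_pos; [apply Hf0 | apply log_weight_inv_nonneg].
      - intros [n m] Hz. destruct (HL _ Hz) as (Hn & _ & [m' Hm]).
        change (2 * P ^ Z.of_nat j)%Z with K in Hn. unfold gnorm in Hn; cbn [fst snd] in *.
        apply in_prod; [apply in_zr | apply in_zr0; split; [lia|]]; nia. }
  set (J := INR (S j)). assert (HJ : 0 < J) by (apply lt_0_INR; lia).
  apply Rlt_le_trans with (lsum (fun _ => g j / (J * c) ^ r) L).
  - rewrite lsum_const, Hlen. replace (j + 1)%nat with (S j) by lia.
    rewrite pow_INR. fold J. unfold g. fold J.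
    rewrite Rpower_Ropp. change 2 with (INR 2). rewrite Rpower_pow by assumption.
    rewrite pow_add, Rpow_mult_distr.
    replace (J ^ r * J ^ 3 * (/ J ^ 2 / (J ^ r * c ^ r))) with (J / c ^ r).
    2:{ field. repeat split; lra || (apply pow_nonzero; lra). }
    apply Rmult_lt_reg_r with (c ^ r); [assumption|].
    replace (J / c ^ r * c ^ r) with J by (field; lra).
    unfold J. rewrite S_INR. lra.
  - apply lsum_le. intros [n m] Hz. destruct (HL _ Hz) as (Hn & _ & [m' Hm]).
    change (2 * P ^ Z.of_nat j)%Z with K in Hn. unfold T. unfold gnorm in Hn; cbn [fst snd] in *.
    replace (qform 1 0 1 m n) with K by (unfold qform; rewrite <- Hn; ring).
    unfold K. rewrite Hfphi. apply Rmult_le_compat_l; [left; apply Rpower_pos|].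
    assert (Hm1 : 1 <= IZR (Z.abs m)) by (apply IZR_le; lia).
    assert (Hl0 : 0 < ln (1 + IZR (Z.abs m))) by (rewrite <- ln_1; apply ln_increasing; lra).
    apply Rinv_le_contravar; [now apply pow_lt|].
    apply pow_incr. split; [lra|].
    replace (J * c) with (ln ((3 * IZR P) ^ S j)).
    2:{ unfold J, c. rewrite <- Rpower_pow by lra. apply ln_exp. }
    apply ln_le; [lra|].
    assert (HmK : (Z.abs m <= K)%Z) by nia.
    assert (Hz3 : (1 + K <= (3 * P) ^ Z.of_nat (S j))%Z).
    { rewrite Nat2Z.inj_succ, Z.pow_succ_r, Z.pow_mul_l by lia. unfold K, phi.
      specialize (HPj j). pose proof (Z.pow_pos_nonneg 3 (Z.of_nat j)).
      assert (1 * P ^ Z.of_nat j <= 3 ^ Z.of_nat j * P ^ Z.of_nat j)%Z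
        by (apply Z.mul_le_mono_nonneg_r; lia).
      nia. }
    rewrite <- mult_IZR, pow_IZR, <- plus_IZR. apply IZR_le. lia.
Qed.

(** Telescoping: ln t <= t - 1, used twice, gives ln ln(x+1) - ln ln x <= (ln(x+1) - ln x) / ln x <=
    1 / (x ln x). *)
Lemma log_log_sum (n : nat) :
  ln (ln (INR (n + 2))) - ln (ln 2) <=
  Defs.sum_nat (fun i => / (INR (i + 2) * ln (INR (i + 2)))) n.
Proof.
  induction n as [|n IH]; [change (INR (0 + 2)) with 2; simpl; lra|]. cbn [Defs.sum_nat].
  set (x := INR (n + 2)) in *.
  replace (INR (S n + 2)) with (x + 1) by (unfold x; rewrite <- S_INR; f_equal; lia).
  assert (Hx : 2 <= x).
  { unfold x. rewrite plus_INR. simpl. pose proof (pos_INR n). lra. }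
  assert (Hl : 0 < ln x) by (rewrite <- ln_1; apply ln_increasing; lra).
  assert (Hl1 : 0 < ln (x + 1)) by (rewrite <- ln_1; apply ln_increasing; lra).
  assert (Hix : 0 < / x) by (apply Rinv_0_lt_compat; lra).
  assert (Hil : 0 < / ln x) by (apply Rinv_0_lt_compat; lra).
  enough (ln (ln (x + 1)) - ln (ln x) <= / (x * ln x)) by lra.
  assert (E : ln (x + 1) - ln x <= / x).
  { assert (T := ln_le_sub_1 ((x + 1) * / x)).
    rewrite ln_mult, ln_Rinv in T by lra.
    replace ((x + 1) * / x) with (1 + / x) in T by (field; lra).
    assert (0 < 1 + / x) by lra. specialize (T H). lra. }
  assert (T := ln_le_sub_1 (ln (x + 1) * / ln x) (Rmult_lt_0_compat _ _ Hl1 Hil)).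
  rewrite ln_mult, ln_Rinv in T by assumption.
  rewrite Rinv_mult.
  apply Rmult_le_compat_r with (r := / ln x) in E; [|lra].
  rewrite Rmult_minus_distr_r, Rinv_r in E by lra. lra.
Qed.

(** Telescoping with U = (ln x)^(-d) / d: the tangent to t^(-d) at ln(x+1) is combined with 1/(x+1)
    <= ln(x+1) - ln x. Only terms after the first are bounded this way, so the first is kept in
    S. *)
Lemma inv_log_pow_sum (p : R) : 1 < p -> exists S, forall n : nat,
  Defs.sum_nat (fun i => / INR (i + 2) * Rpower (ln (INR (i + 2))) (- p)) n <= S.
Proof.
  intros Hp. set (d := p - 1). assert (Hd : 0 < d) by (unfold d; lra).
  set (t := fun i : nat => / INR (i + 2) * Rpower (ln (INR (i + 2))) (- p)).
  set (U := fun i : nat => / d * Rpower (ln (INR (i + 2))) (- d)).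
  assert (Hid : 0 < / d) by now apply Rinv_0_lt_compat.
  assert (HU : forall i, 0 <= U i).
  { intros i. apply Rmult_le_pos; [lra | left; apply Rpower_pos]. }
  assert (Ht : forall i, 0 <= t i).
  { intros i. apply Rmult_le_pos; [|left; apply Rpower_pos].
    left. apply Rinv_0_lt_compat, lt_0_INR. lia. }
  assert (Hstep : forall i, t (S i) <= U i - U (S i)).
  { intros i. unfold t, U. set (x := INR (i + 2)).
    replace (INR (S i + 2)) with (x + 1) by (unfold x; rewrite <- S_INR; f_equal; lia).
    assert (Hx : 2 <= x).
    { unfold x. rewrite plus_INR. simpl. pose proof (pos_INR i). lra. }
    assert (Hl : 0 < ln x) by (rewrite <- ln_1; apply ln_increasing; lra).
    assert (Hl1 : 0 < ln (x + 1)) by (rewrite <- ln_1; apply ln_increasing; lra).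
    assert (T := Rpower_neg_tangent d (ln (x + 1)) (ln x) Hd Hl1 Hl).
    replace (- d - 1) with (- p) in T by (unfold d; ring).
    assert (Hix : 0 < / (x + 1)) by (apply Rinv_0_lt_compat; lra).
    assert (E : / (x + 1) <= ln (x + 1) - ln x).
    { assert (T' := ln_le_sub_1 (x * / (x + 1))).
      rewrite ln_mult, ln_Rinv in T' by lra.
      replace (x * / (x + 1)) with (1 - / (x + 1)) in T' by (field; lra).
      assert (H1 : / (x + 1) < 1) by (rewrite <- Rinv_1; apply Rinv_lt_contravar; lra).
      specialize (T' ltac:(lra)). lra. }
    pose proof (Rpower_pos (ln (x + 1)) (- p)) as Hq.
    apply Rmult_le_compat_l with (r := / d) in T; [|lra].
    rewrite Rmult_plus_distr_l in T.
    replace (/ d * (d * Rpower (ln (x + 1)) (- p) * (ln (x + 1) - ln x)))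
      with (Rpower (ln (x + 1)) (- p) * (ln (x + 1) - ln x)) in T by (field; lra).
    apply Rmult_le_compat_l with (r := Rpower (ln (x + 1)) (- p)) in E; [|lra].
    lra. }
  exists (t 0%nat + U 0%nat). intros n.
  destruct n as [|n]; [simpl; specialize (Ht 0%nat); specialize (HU 0%nat); lra|].
  enough (Defs.sum_nat t (S n) <= t 0%nat + U 0%nat - U n) by (specialize (HU n); lra).
  induction n as [|n IH]; [simpl; lra|].
  cbn [Defs.sum_nat] in *. specialize (Hstep n). lra.
Qed.

Lemma ln_unbounded (M : R) : exists n : nat, M < ln (INR (n + 2)).
Proof.
  destruct (INR_unbounded (exp M)) as [n Hn]. exists n.
  rewrite <- (ln_exp M). apply ln_increasing; [apply exp_pos|].
  rewrite plus_INR. simpl. lra.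
Qed.

Lemma ln_ln_unbounded (M : R) : exists n : nat, M < ln (ln (INR (n + 2))).
Proof.
  destruct (ln_unbounded (exp M)) as [n Hn]. exists n.
  rewrite <- (ln_exp M). apply ln_increasing; [apply exp_pos | assumption].
Qed.

Lemma sharpness_power (p : R) : 1 < p ->
   exists f : Z -> R, (forall k, 0 <= f k) /\
     (exists B : R, forall N : nat, sumZ N (fun k => rpow (f k) p) <= B) /\
     (forall M : R, exists N : nat,
        M < sumZ N (fun n => rpow (sumZ0 N (fun m =>
              f (qform 1 0 1 m n) / absZpow m (1 - / p))) p)).
Proof.
  intros Hp.
  (* The squares m^2 with m = i + 2; starting at 2 keeps ln m positive. In the row n = 0 the powers
     of m combine to 1 / (m ln m). *)
  set (phi := fun i => ((Z.of_nat i + 2) * (Z.of_nat i + 2))%Z).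
  set (g := fun i => Rpower (INR (i + 2)) (- / p) * / ln (INR (i + 2))).
  assert (Hx : forall i, 2 <= INR (i + 2)).
  { intros i. rewrite plus_INR. simpl. pose proof (pos_INR i). lra. }
  assert (Hl : forall i, 0 < ln (INR (i + 2))).
  { intros i. specialize (Hx i). rewrite <- ln_1; apply ln_increasing; lra. }
  assert (Hg : forall i, 0 < g i).
  { intros i. apply Rmult_lt_0_compat; [apply Rpower_pos | apply Rinv_0_lt_compat, Hl]. }
  destruct (pushforward phi g) as (f & Hf0 & Hfphi & Hsum).
  { intros i. unfold phi. nia. }
  { intros i j E. unfold phi in E. nia. }
  { intros i. left. apply Hg. }
  exists f. split; [assumption|]. split.
  { destruct (inv_log_pow_sum p Hp) as [S HS]. exists S.
    apply (Hsum (fun x => rpow x p)); [apply rpow_0 | intros; apply rpow_nonneg |].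
    intros n. eapply Rle_trans; [|apply (HS n)]. right.
    rewrite !sum_nat_lsum. apply lsum_ext. intros i _.
    rewrite rpow_pos_eq by apply Hg. unfold g.
    rewrite <- Rpower_mult_distr by (apply Rpower_pos || apply Rinv_0_lt_compat, Hl).
    rewrite Rpower_mult. f_equal.
    - replace (- / p * p) with (- (1)) by (field; lra).
      rewrite Rpower_Ropp, Rpower_1; [reflexivity | specialize (Hx i); lra].
    - unfold Rpower. rewrite ln_Rinv by apply Hl. f_equal. ring. }
  (* A row sum exceeding 1 is at most its own p-th power, so divergence of the row passes to the
     power. *)
  intros M. set (M1 := Rmax 1 M).
  destruct (ln_ln_unbounded (M1 + ln (ln 2))) as [n0 Hn0].
  exists (n0 + 2)%nat. set (N := (n0 + 2)%nat) in *.
  set (h := fun m => f (qform 1 0 1 m 0) / absZpow m (1 - / p)).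
  assert (Hh : forall m, 0 <= h m).
  { intros m. apply Rmult_le_pos; [apply Hf0 | apply absZpow_inv_nonneg]. }
  assert (HT : M1 < sumZ0 N h).
  { apply Rlt_le_trans with (Defs.sum_nat (fun i => / (INR (i + 2) * ln (INR (i + 2)))) n0).
    { pose proof (log_log_sum n0). unfold N in Hn0. lra. }
    rewrite sumZ0_lsum, sum_nat_lsum.
    apply Rle_trans with (lsum h (map (fun i => Z.of_nat i + 2)%Z (seq 0 n0))).
    - right. rewrite lsum_map. apply lsum_ext. intros i _. unfold h.
      replace (qform 1 0 1 (Z.of_nat i + 2) 0) with (phi i) by (unfold qform, phi; ring).
      rewrite Hfphi, absZpow_eq by lia.
      rewrite Z.abs_eq by lia.
      replace (IZR (Z.of_nat i + 2)) with (INR (i + 2))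
        by (rewrite INR_IZR_INZ; f_equal; lia).
      unfold g, Rdiv. rewrite <- Rpower_Ropp, Rinv_mult.
      replace (/ INR (i + 2)) with (Rpower (INR (i + 2)) (- / p + - (1 - / p))).
      + rewrite Rpower_plus. ring.
      + replace (- / p + - (1 - / p)) with (- (1)) by ring.
        rewrite Rpower_Ropp, Rpower_1; [reflexivity | specialize (Hx i); lra].
    - apply lsum_incl; [assumption | |].
      + apply Injective_map_NoDup; [intros x y; lia | apply seq_NoDup].
      + intros m Hm. apply in_map_iff in Hm as (i & <- & Hi). apply in_seq in Hi.
        apply in_zr0. unfold N. lia. }
  rewrite sumZ_lsum. unfold zr. cbn [lsum fold_right].
  match goal with |- _ < _ + ?t => assert (Hrest : 0 <= t) end.
  { apply (lsum_nonneg (fun n => rpow (sumZ0 N (fun m =>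
              f (qform 1 0 1 m n) / absZpow m (1 - / p))) p)). intros n _. apply rpow_nonneg. }
  assert (H1 : 1 <= M1) by apply Rmax_l. assert (H2 : M <= M1) by apply Rmax_r.
  assert (Hpow : sumZ0 N h <= rpow (sumZ0 N h) p).
  { rewrite rpow_pos_eq by lra. rewrite <- (Rpower_1 (sumZ0 N h)) at 1 by lra.
    apply Rle_Rpower; lra. }
  change (sumZ0 N (fun m => f (qform 1 0 1 m 0) / absZpow m (1 - / p))) with (sumZ0 N h). lra.
Qed.

(** The harmonic series dominates the logarithm, since ln(x+1) - ln x <= 1/x. *)
Lemma sharpness_linf (M : R) : exists N : nat, M < sumZ0 N (fun m => 1 / absZpow m 1).
Proof.
  destruct (ln_unbounded M) as [n Hn]. exists (n + 1)%nat.
  enough (H : forall k, ln (INR (k + 1)) <= sumZ0 k (fun m => 1 / absZpow m 1)).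
  { specialize (H (n + 1)%nat). replace (n + 1 + 1)%nat with (n + 2)%nat in H by lia. lra. }
  induction k as [|k IH].
  - simpl. rewrite ln_1. unfold sumZ0. simpl. lra.
  - unfold sumZ0 in *. cbn [Defs.sum_nat].
    rewrite !absZpow_eq, Z.abs_opp, Z.abs_eq, <- INR_IZR_INZ, Rpower_1
      by (lia || (apply lt_0_INR; lia)).
    set (x := INR (k + 1)) in *.
    assert (Hx : 0 < x) by (apply lt_0_INR; lia).
    replace (INR (S k)) with x by (unfold x; f_equal; lia).
    replace (INR (S k + 1)) with (x + 1) by (unfold x; rewrite <- S_INR; f_equal; lia).
    assert (Hix : 0 < / x) by now apply Rinv_0_lt_compat.
    assert (T := ln_le_sub_1 ((x + 1) * / x)).
    rewrite ln_mult, ln_Rinv in T by lra.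
    replace ((x + 1) * / x) with (1 + / x) in T by (field; lra).
    specialize (T ltac:(lra)). unfold Rdiv. lra.
Qed.

Theorem theorem1 :
  (* boundedness, 1 <= p < oo, lambda > 1 - 1/p *)
  (forall (p lam : R), 1 <= p -> 1 - / p < lam ->
   forall D : Z, (D < 0)%Z ->
   exists C : R, 0 <= C /\
   forall (a b c : Z), (qdisc a b c = D)%Z ->
   forall (f : Z -> Cx) (B : R), 0 <= B -> lp_bounded p f B ->
   exists F : Z -> Cx,
     (forall n : Z, I_converges_to a b c lam f n (F n)) /\
     lp_bounded p F (C * B))
  /\
  (* boundedness, p = oo, lambda > 1 *)
  (forall (lam : R), 1 < lam ->
   forall D : Z, (D < 0)%Z ->
   exists C : R, 0 <= C /\
   forall (a b c : Z), (qdisc a b c = D)%Z ->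
   forall (f : Z -> Cx) (B : R), 0 <= B -> linf_bounded f B ->
   exists F : Z -> Cx,
     (forall n : Z, I_converges_to a b c lam f n (F n)) /\
     linf_bounded F (C * B))
  /\
  (* sharpness (i): p = 1, log^r weights *)
  (forall r : nat,
   exists (a b c : Z), (0 < a)%Z /\ (qdisc a b c < 0)%Z /\
   exists f : Z -> R, (forall k, 0 <= f k) /\
     (exists B : R, forall N : nat, sumZ N f <= B) /\
     (forall M : R, exists N : nat,
        M < sumZ N (fun n => sumZ0 N (fun m =>
              f (qform a b c m n) / (ln (1 + IZR (Z.abs m))) ^ r))))
  /\
  (* sharpness (ii): 1 < p < oo, lambda = 1 - 1/p *)
  (forall p : R, 1 < p ->
   exists (a b c : Z), (0 < a)%Z /\ (qdisc a b c < 0)%Z /\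
   exists f : Z -> R, (forall k, 0 <= f k) /\
     (exists B : R, forall N : nat, sumZ N (fun k => rpow (f k) p) <= B) /\
     (forall M : R, exists N : nat,
        M < sumZ N (fun n => rpow (sumZ0 N (fun m =>
              f (qform a b c m n) / absZpow m (1 - / p))) p)))
  /\
  (* sharpness (iii): p = oo, lambda = 1 *)
  (exists (a b c : Z), (0 < a)%Z /\ (qdisc a b c < 0)%Z /\
   exists f : Z -> R, (forall k, 0 <= f k) /\
     (exists B : R, forall k : Z, f k <= B) /\
     (forall M : R, exists (n : Z) (N : nat),
        M < sumZ0 N (fun m => f (qform a b c m n) / absZpow m 1))).
Proof.
  split; [|split; [|split; [|split]]].
  - intros p lam Hp Hlam D HD. now apply lp_boundedness.
  - intros lam Hlam D HD. destruct (linf_boundedness lam Hlam) as (C & HC & H).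
    exists C. split; [assumption|]. intros a b c _. apply H.
  - intros r. exists 1%Z, 0%Z, 1%Z. split; [lia|]. split; [reflexivity|].
    apply sharpness_log.
  - intros p Hp. exists 1%Z, 0%Z, 1%Z. split; [lia|]. split; [reflexivity|].
    now apply sharpness_power.
  - exists 1%Z, 0%Z, 1%Z. split; [lia|]. split; [reflexivity|].
    exists (fun _ => 1). split; [intros; lra|]. split; [exists 1; intros; lra|].
    intros M. exists 0%Z. apply sharpness_linf.
Qed.
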